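(* There exist universal constants $C,F_2,G_2>0$ such that the following holds. Let $\Theta$ be a positive integer, let $I=[a,b]$, and let $\nu$ be a probability measure on $I$ with density $\nu(x)$. Let $N,m,s$ be positive integers with $$m\ge C s\log^3(s)\log(N+1).$$ Let $\{\psi_0,\psi_1,\dots,\psi_N\}$ be polynomials on $I$ that are orthonormal with respect to $\nu$, whose degrees are strictly increasing and do not exceed $N$. Let $\boldsymbol{\omega}=(\omega_0,\dots,\omega_N)^T$ be a weight vector with $\omega_j\ge\|\psi_j\|_\infty$ for $j=0,1,\dots,N$, and suppose $s\ge 2\|\boldsymbol{\omega}\|_\infty^2$. Let $x_1,\dots,x_m$ be drawn independently from $I$, each with probability density $\nu(x)$, and let $A\in\mathbb{R}^{m\times(N+1)}$ have entries $A_{j,k}=\psi_k(x_j)$, $j=1,\dots,m$, $k=0,\dots,N$. Let $f\in C[a,b]$ be arbitrary, put $\mathbf{y}=(f(x_1),\dots,f(x_m))^T$, let $p_{opt}$ be the best square approximation polynomial of $f$ in $\Pi_N(I)=\mathrm{span}\{\psi_0,\dots,\psi_N\}$, let $\mathbf{c_{opt}}$ be the coefficient vector of $p_{opt}$ in the basis $\{\psi_k\}_{k=0}^N$, and let $T_N=f-p_{opt}$. Then, with probability at least $1-(N+1)^{-\log^3(3s)}$, the following holds: if $\mathbf{c}^\#=(c_0^\#,\dots,c_N^\#)^T$ is a solution of $$\min_{\mathbf{z}\in\mathbb{R}^{N+1}}\|\mathbf{z}\|_{\boldsymbol{\omega},1}\quad\text{subject to}\quad\|A\mathbf{z}-\mathbf{y}\|_2\le\Theta\sqrt{m}\,\|T_N\|_\infty,$$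 and $p^\#=\sum_{k=0}^N c_k^\#\psi_k$, then $$\|f-p^\#\|_2\le\|T_N\|_2+F_2\frac{\sigma_s(\mathbf{c_{opt}})_{\boldsymbol{\omega},1}}{\sqrt{s}}+\Theta G_2\|T_N\|_\infty.$$
   Context: $\|g\|_\infty=\max_{x\in[a,b]}|g(x)|$ and, for functions, $\|g\|_2=\left(\int_a^b g(x)^2\nu(x)\,dx\right)^{1/2}$; for vectors $\|\cdot\|_2$ and $\|\cdot\|_\infty$ are the usual $\ell_2$ and max norms. $\Pi_N(I)$ is the space of polynomials on $I$ of degree at most $N$. The best square approximation polynomial $p_{opt}\in\Pi_N(I)$ satisfies $\|f-p_{opt}\|_2=\inf_{p\in\Pi_N(I)}\|f-p\|_2$. Orthonormal with respect to $\nu$ means $\int_I\psi_j(x)\psi_k(x)\nu(x)\,dx=\delta_{jk}$. Weighted notions: weights satisfy $\omega_j\ge1$; $\|\mathbf{z}\|_{\boldsymbol{\omega},1}=\sum_j\omega_j|z_j|$; $\|\mathbf{z}\|_{\boldsymbol{\omega},0}=\sum_{\{j:z_j\ne0\}}\omega_j^2$; the weighted best $s$-term approximation error is $\sigma_s(\mathbf{x})_{\boldsymbol{\omega},1}=\inf\{\|\mathbf{x}-\mathbf{z}\|_{\boldsymbol{\omega},1}:\|\mathbf{z}\|_{\boldsymbol{\omega},0}\le s\}$. ''Universal constants'' means independent of all the other data. *)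

(* Defs.v *)
From HB Require Import structures.
From mathcomp Require Import all_boot all_order all_algebra.
From mathcomp Require Import all_classical all_reals all_analysis.
Set Implicit Arguments.
Unset Strict Implicit.
Unset Printing Implicit Defensive.
Import Order.TTheory GRing.Theory Num.Theory.
Import numFieldNormedType.Exports.

Local Open Scope classical_set_scope.
Local Open Scope ring_scope.

Section FunctionsOnInterval.
Context {R : realType}.
Implicit Types (a b : R) (nu f g : R -> R) (p : {poly R}).

Definition is_density a b nu : Prop :=
  [/\ measurable_fun `[a, b] nu,
      forall x, x \in `[a, b] -> 0 <= nu x
    & (\int[lebesgue_measure]_(x in `[a, b]) (nu x)%:E = 1)%E].

(* For g continuous on `[a, b] with a < b the supremum is attained, so this is
   the maximum of |g|. *)
Definition sup_norm a b g : R := sup [set `|g x| | x in `[a, b]].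

(* The real-valued integral is 0 when the extended one is infinite; this does
   not occur for g continuous on `[a, b] and nu a density there. *)
Definition L2_norm a b nu g : R :=
  Num.sqrt (\int[lebesgue_measure]_(x in `[a, b]) (g x ^+ 2 * nu x)).

Definition orthonormal_polys a b nu n (psi : 'I_n -> {poly R}) : Prop :=
  forall j k, \int[lebesgue_measure]_(x in `[a, b])
    ((psi j).[x] * (psi k).[x] * nu x) = (j == k)%:R.

Definition poly_residual f p : R -> R := fun x => f x - p.[x].

Definition is_best_approx a b nu f N p : Prop :=
  (size p <= N.+1)%N /\
  L2_norm a b nu (poly_residual f p) =
    inf [set L2_norm a b nu (poly_residual f q)
          | q in [set q : {poly R} | (size q <= N.+1)%N]].

End FunctionsOnInterval.

Section Sampling.
Local Open Scope ereal_scope.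
Context {R : realType} {d : measure_display} {T : measurableType d}.
Variable P : probability T R.

Definition mutually_independent (I : finType) (X : I -> {RV P >-> R}) : Prop :=
  forall (J : {set I}) (B : I -> set R), (forall j, measurable (B j)) ->
    P (\bigcap_(j in [set` J]) (X j @^-1` B j)) =
    \prod_(j in J) P (X j @^-1` B j).

(* X has law nu(x) dx on `[a, b]; in particular X lies in `[a, b] almost
   surely. *)
Definition has_density_on (a b : R) (nu : R -> R) (X : {RV P >-> R}) : Prop :=
  forall B : set R, measurable B ->
    distribution P X B =
    \int[lebesgue_measure]_(x in B `&` `[a, b]) (nu x)%:E.

End Sampling.

Section Vectors.
Context {R : realType}.

Definition l2_norm n (v : 'cV[R]_n) : R := Num.sqrt (\sum_i v i 0 ^+ 2).

Definition wl1_norm n (w z : 'cV[R]_n) : R := \sum_j w j 0 * `|z j 0|.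

Definition wl0_norm n (w z : 'cV[R]_n) : R :=
  \sum_(j | z j 0 != 0) w j 0 ^+ 2.

Definition best_sterm_error n (s : R) (w x : 'cV[R]_n) : R :=
  inf [set wl1_norm w (x - z) | z in [set z | wl0_norm w z <= s]].

Definition lin_comb n (psi : 'I_n -> {poly R}) (c : 'cV[R]_n) : {poly R} :=
  \sum_k c k 0 *: psi k.

Definition sampling_matrix m n (psi : 'I_n -> {poly R}) (x : 'I_m -> R) :
  'M[R]_(m, n) := \matrix_(j, k) (psi k).[x j].

Definition sample_vector m (f : R -> R) (x : 'I_m -> R) : 'cV[R]_m :=
  \col_j f (x j).

Definition is_wl1_minimizer m n (w : 'cV[R]_n) (A : 'M[R]_(m, n))
    (y : 'cV[R]_m) (eta : R) (c : 'cV[R]_n) : Prop :=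
  l2_norm (A *m c - y) <= eta /\
  forall z, l2_norm (A *m z - y) <= eta -> wl1_norm w c <= wl1_norm w z.

End Vectors.

(* Main.v *)
Require Import Defs.
From HB Require Import structures.
From mathcomp Require Import all_boot all_order all_algebra.
From mathcomp Require Import all_classical all_reals all_analysis.
From mathcomp Require Import measurable_realfun zify ring lra.
Set Implicit Arguments.
Unset Strict Implicit.
Unset Printing Implicit Defensive.
Import Order.TTheory GRing.Theory Num.Theory.
Import numFieldNormedType.Exports.
Local Open Scope classical_set_scope.
Local Open Scope ring_scope.

(** The error v = c_opt - c# either satisfies sqrt(s) |v|_2 <= sigma_s, or lies
    in the cone |v|_{w,1} <= 4 sqrt(s) |v|_2. It therefore suffices that, with
    high probability, |A v|_2^2 >= c m |v|_2^2 on this cone; no upper isometry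
    bound is needed. Up to scaling, the functions g = sum_k v_k psi_k of the cone
    lie in the convex hull of the functions +-psi_k / w_k, which are bounded
    by 1, and have mean square rho = 1 / (16 s).

    The mean of g^2 is comparable to sum_k 4^-k P(|g| >= 2^-k) over the O(log s)
    levels k. At level k, Maurey's empirical method replaces g, up to an error
    2^-k / 4 outside a set of tiny measure, by an average of O(4^k log s)
    dictionary elements. There are finitely many such averages, and for each of
    them a Chernoff bound controls the fraction of samples in its superlevel
    set. Both the number of samples needed to see a level and the logarithm of
    the number of averages scale like 4^k, so that the union bound closes. *)

(** * Maurey's empirical method *)

Section FiniteProbability.
Context {R : realType}.

(** From [1 - x <= expR (- x)] one gets [expR x <= 1 / (1 - x)], and [(1 - x)(1 + x + 2 x^2) = 1 +
    x^2 (1 - 2 x) >= 1]. *)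
Lemma expR_le_quadratic (x : R) : `|x| <= 2^-1 -> expR x <= 1 + x + 2 * x ^+ 2.
Proof.
move=> hx; have [h1 h2] : - 2^-1 <= x /\ x <= 2^-1 by move: hx; rewrite ler_norml => /andP.
have x1 : 0 < 1 - x by lra.
have e1 : expR x * (1 - x) <= 1.
  have := expR_ge1Dx (- x); rewrite expRN => h.
  rewrite -[leRHS](@mulfV _ (expR x)) ?gt_eqF ?expR_gt0//.
  by rewrite ler_pM2l ?expR_gt0.
rewrite -(ler_pM2r x1) (le_trans e1) //.
have : 0 <= x ^+ 2 * (1 - 2 * x) by rewrite mulr_ge0 ?sqr_ge0 //; lra.
by move=> h; lra.
Qed.

Context {D : finType}.
Variable lam : D -> R.
Hypothesis lam_ge0 : forall d, 0 <= lam d.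
Hypothesis lam_sum : \sum_d lam d = 1.

Lemma mean_le1 (y : D -> R) : (forall d, `|y d| <= 1) ->
  `|\sum_d lam d * y d| <= 1.
Proof.
move=> y1; rewrite (le_trans (ler_norm_sum _ _ _))// -lam_sum ler_sum// => d _.
by rewrite normrM ger0_norm// ler_piMr.
Qed.

(** The centred variable is at most 2 in absolute value, so [th <= 1/4] keeps the exponent in the
    range of the quadratic bound. The linear term averages to zero and the quadratic one is at most
    [8 th^2]. *)
Lemma mgf_bounded (y : D -> R) (th : R) : (forall d, `|y d| <= 1) ->
  0 <= th <= 4^-1 ->
  \sum_d lam d * expR (th * (y d - \sum_e lam e * y e)) <= expR (8 * th ^+ 2).
Proof.
move=> y1 /andP[th0 th1]; set c := \sum_e lam e * y e.
have c1 : `|c| <= 1 by apply: (mean_le1 y1).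
apply: (@le_trans _ _ (\sum_d (lam d * (1 + 8 * th ^+ 2) +
    th * (lam d * y d - lam d * c)))).
  apply: ler_sum => d _.
  have -> : lam d * (1 + 8 * th ^+ 2) + th * (lam d * y d - lam d * c) =
    lam d * (1 + th * (y d - c) + 8 * th ^+ 2) by ring.
  rewrite ler_wpM2l//.
  have yc : `|y d - c| <= 2.
    by rewrite (le_trans (ler_normB _ _))//; have := y1 d; lra.
  apply: le_trans (expR_le_quadratic _) _.
    by rewrite normrM (ger0_norm th0); nra.
  rewrite lerD2l exprMn.
  have : (y d - c) ^+ 2 <= 4.
    by move: yc; rewrite ler_norml => /andP[yc1 yc2]; nra.
  have := sqr_ge0 th; nra.
rewrite big_split /= -mulr_suml lam_sum -mulr_sumr big_split /= -/c sumrN.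
rewrite -mulr_suml lam_sum !mul1r subrr mulr0 addr0.
exact: expR_ge1Dx.
Qed.

(** Chernoff's bound for [q] independent draws from [lam]: a tuple [J] has probability
    [\prod_l lam (J l)], and the exponential moment factorises over the draws. *)
Lemma maurey_tail1 (q : nat) (y : D -> R) (tau : R) : (forall d, `|y d| <= 1) ->
  0 <= tau <= 4 ->
  \sum_(J : {ffun 'I_q -> D}) (\prod_l lam (J l)) *
     (q%:R * tau < \sum_l y (J l) - q%:R * \sum_e lam e * y e)%R%:R
  <= expR (- (q%:R * tau ^+ 2 / 32)).
Proof.
move=> y1 /andP[tau0 tau4]; set c := \sum_e lam e * y e.
(* This minimises [8 th^2 - th tau], with minimum [- tau^2 / 32]; the condition [tau <= 4] gives
   [th <= 1/4]. *)
pose th := tau / 16.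
have th0 : 0 <= th by rewrite /th; lra.
apply: (@le_trans _ _ (expR (- (th * (q%:R * tau))) *
  \sum_(J : {ffun 'I_q -> D}) \prod_l (lam (J l) * expR (th * (y (J l) - c))))).
  rewrite [leRHS]mulr_sumr; apply: ler_sum => J _.
  rewrite big_split /= mulrCA ler_wpM2l ?prodr_ge0//.
  rewrite -expR_sum -expRD -mulr_sumr big_split /= sumrN sumr_const card_ord.
  rewrite -[c *+ q]mulr_natl.
  case: ltP => h /=; last exact: expR_ge0.
  by rewrite -[leLHS]expR0 ler_expR -mulrN -mulrDr mulr_ge0//; lra.
rewrite -(bigA_distr_bigA (fun (l : 'I_q) d => lam d * expR (th * (y d - c)))) /=.
rewrite prodr_const card_ord.
apply: (@le_trans _ _ (expR (- (th * (q%:R * tau))) * expR (8 * th ^+ 2) ^+ q)).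
  rewrite ler_wpM2l ?expR_ge0// lerXn2r ?nnegrE ?expR_ge0//.
    by apply: sumr_ge0 => d _; rewrite mulr_ge0 ?expR_ge0.
  by apply: mgf_bounded => //; rewrite th0 /th; lra.
rewrite -expRM_natl -expRD ler_expR /th.
by rewrite le_eqVlt; apply/orP; left; apply/eqP; field.
Qed.

Lemma maurey_tail (q : nat) (y : D -> R) (tau : R) : (0 < q)%N ->
  (forall d, `|y d| <= 1) -> 0 <= tau <= 4 ->
  \sum_(J : {ffun 'I_q -> D}) (\prod_l lam (J l)) *
     (tau < `|q%:R^-1 * \sum_l y (J l) - \sum_e lam e * y e|)%R%:R
  <= 2 * expR (- (q%:R * tau ^+ 2 / 32)).
Proof.
move=> q0 y1 tau04; set c := \sum_e lam e * y e.
have q0' : 0 < q%:R :> R by rewrite ltr0n.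
have h1 := maurey_tail1 q y1 tau04.
have /= h2 := @maurey_tail1 q (fun d => - y d) tau _ tau04.
have hc : \sum_e lam e * - y e = - c.
  by rewrite -sumrN; apply: eq_bigr => e _; rewrite mulrN.
rewrite mulrDl mul1r; apply: le_trans (lerD h1 (h2 _)); last first.
  by move=> d; rewrite normrN.
rewrite -big_split /= ler_sum// => J _.
rewrite -mulrDr ler_wpM2l ?prodr_ge0// hc -/c sumrN mulrN opprK.
have -> : q%:R^-1 * \sum_l y (J l) - c = q%:R^-1 * (\sum_l y (J l) - q%:R * c).
  by field; rewrite gt_eqF.
rewrite normrM gtr0_norm ?invr_gt0// ltr_pdivlMl//.
set z := \sum_l _ - _; set t := q%:R * tau.
have -> : - \sum_l y (J l) + q%:R * c = - z by rewrite /z; ring.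
rewrite lter_normr; case: (t < z); case: (t < - z) => //=; lra.
Qed.

End FiniteProbability.

(** * Lower tails of sample counts *)

Section IndependentSampling.
Context {R : realType} {d : measure_display} {T : measurableType d}.
Variable P : probability T R.

Lemma measurable_bigsetU (I : finType) (Q : pred I) (A : I -> set T) :
  (forall i, Q i -> measurable (A i)) ->
  measurable (\big[setU/set0]_(i | Q i) A i).
Proof.
move=> mA; apply: (big_ind measurable) => //.
by move=> x y mx my; exact: measurableU.
Qed.

Lemma finite_union_bound (I : finType) (Q : pred I) (A : I -> set T)
    (r : I -> R) :
  (forall i, Q i -> measurable (A i)) ->
  (forall i, Q i -> (P (A i) <= (r i)%:E)%E) ->
  (P (\big[setU/set0]_(i | Q i) A i) <= (\sum_(i | Q i) r i)%:E)%E.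
Proof.
move=> mA Ar.
suff : measurable (\big[setU/set0]_(i | Q i) A i) /\
   (P (\big[setU/set0]_(i | Q i) A i) <= (\sum_(i | Q i) r i)%:E)%E by case.
elim/big_rec2 : _ => [|i y x Qi [mx xy]]; first by rewrite measure0.
split; first exact: measurableU (mA _ Qi) mx.
apply: (le_trans (measureU2 _ (mA _ Qi) mx)).
by rewrite EFinD; apply: leeD => //; exact: Ar.
Qed.

Variables (m : nat) (X : 'I_m -> {RV P >-> R}).
Hypothesis indepX : mutually_independent X.

Lemma measurable_preimage_RV (Y : {RV P >-> R}) (B : set R) :
  measurable B -> measurable (Y @^-1` B).
Proof. by move=> mB; rewrite -[_ @^-1` _]setTI; exact: measurable_funP. Qed.

(** The event is a union of atoms, one for each exact set [S] of indices whose samples fall into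
    [B]. Independence makes the probability of an atom a product, so that an exponential moment
    factorises over the samples. *)
Lemma count_lower_tail (B : set R) (p : R) : (0 < m)%N -> measurable B ->
  (forall i, P (X i @^-1` B) = p%:E) ->
  let lowcount := [set t | \sum_i \1_B (X i t) < m%:R * p / 4] in
  measurable lowcount /\ (P lowcount <= (expR (- (m%:R * p / 4)))%:E)%E.
Proof.
move=> m0 mB pB lowcount.
pose r := m%:R * p / 4.
pose side (S : {set 'I_m}) (j : 'I_m) : set R := if j \in S then B else ~` B.
pose ev (S : {set 'I_m}) : set T := \bigcap_(j in [set` [set: 'I_m]%SET]) (X j @^-1` side S j).
have mside S j : measurable (side S j).
  by rewrite /side; case: ifP => // _; exact: measurableC.
have mev S : measurable (ev S).
  rewrite /ev; apply: fin_bigcap_measurable; first exact: finite_finset.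
  by move=> j _; exact: measurable_preimage_RV.
have evE S t : ev S t -> \sum_i \1_B (X i t) = #|S|%:R :> R.
  move=> evt; rewrite -sum1_card natr_sum [RHS]big_mkcond /=.
  apply: eq_bigr => i _; rewrite indicE.
  have := evt i; rewrite /= inE => /(_ isT); rewrite /side.
  by case: ifP => _; [move/mem_set => -> | move=> nB; rewrite memNset].
have lowE : lowcount = \big[setU/set0]_(S : {set 'I_m} | #|S|%:R < r) ev S.
  apply/seteqP; split => t.
    move=> lt; pose S : {set 'I_m} := [set i | X i t \in B]%SET.
    have evS : ev S t.
      move=> j _; rewrite /side /= inE.
      by case: ifP => [/set_mem //|/negbT]; rewrite notin_setE.
    rewrite (bigD1 S) /=; first by left.
    by move: lt; rewrite /lowcount /= (evE S).
  have : forall x, (\big[setU/set0]_(S : {set 'I_m} | #|S|%:R < r) ev S) x -> lowcount x.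
    apply: (big_ind (fun Z : set T => forall x, Z x -> lowcount x)) => //.
      by move=> Y Z hY hZ x [/hY|/hZ].
    by move=> S Sr x evx; rewrite /lowcount /= (evE S).
  exact.
rewrite lowE; split; first exact: measurable_bigsetU.
have p01 : 0 <= p <= 1.
  have := pB (Ordinal m0) => pE.
  by rewrite -!lee_fin -pE measure_ge0 probability_le1//; exact: measurable_preimage_RV.
pose pr (S : {set 'I_m}) : R := \prod_(j : 'I_m) (if j \in S then p else 1 - p).
have Pev S : P (ev S) = (pr S)%:E.
  rewrite /ev indepX// /pr (big_morph EFin (@EFinM R) (erefl 1%:E)); apply: eq_big => [j|j _]; first by rewrite inE.
  rewrite /side; case: ifP => // _.
  by rewrite preimage_setC probability_setC ?pB//; exact: measurable_preimage_RV.
apply: (@le_trans _ _ (\sum_(S : {set 'I_m} | #|S|%:R < r) pr S)%:E).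
  by apply: finite_union_bound => // S _; rewrite Pev.
rewrite lee_fin.
have [p0 p1] : 0 <= p /\ p <= 1 by move/andP: p01.
have pr0 S : 0 <= pr S by apply: prodr_ge0 => j _; case: ifP => _; lra.
(* [1_{#|S| < r} <= exp (r - #|S|)], and the right-hand side factorises *)
apply: (@le_trans _ _ (\sum_(S : {set 'I_m}) expR r *
   \prod_(j : 'I_m) (if j \in S then p * expR (-1) else 1 - p))).
  rewrite big_mkcond /=; apply: ler_sum => S _.
  have -> : \prod_(j : 'I_m) (if j \in S then p * expR (-1) else 1 - p) =
      pr S * expR (- #|S|%:R).
    rewrite -[#|S|%:R]mulr1 -mulrN expRM_natl -prodr_const [in RHS]big_mkcond /pr -big_split /=.
    by apply: eq_bigr => j _; case: ifP; rewrite ?mulr1.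
  rewrite mulrCA -expRD.
  case: ifP => h; last by rewrite mulr_ge0 ?expR_ge0.
  by rewrite ler_peMr// -[leLHS]expR0 ler_expR subr_ge0 ltW.
rewrite -mulr_sumr.
have -> : \sum_(S : {set 'I_m}) \prod_(j : 'I_m)
    (if j \in S then p * expR (-1) else 1 - p) = (p * expR (-1) + (1 - p)) ^+ m.
  rewrite -[in RHS](card_ord m) -prodr_const.
  rewrite (bigA_distr _ _ (fun=> p * expR (-1)) (fun=> 1 - p)).
  by apply: eq_bigl => S; rewrite inE.
have e1 : expR (-1) <= 2^-1 :> R.
  by rewrite expRN lef_pV2 ?posrE ?expR_gt0//; have := expR_ge1Dx (1 : R); lra.
have e0 : 0 <= expR (-1) :> R := expR_ge0 _.
(* As [expR (-1) <= 1/2], the base is at most [1 - p/2 <= expR (- (p / 2))]; with [r = m p / 4] the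
   total exponent is [- m p / 4]. *)
apply: (@le_trans _ _ (expR r * expR (- (p / 2)) ^+ m)).
  rewrite ler_wpM2l ?expR_ge0// lerXn2r ?nnegrE ?expR_ge0//.
    by rewrite addr_ge0 ?mulr_ge0//; lra.
  by apply: le_trans (expR_ge1Dx _); nra.
rewrite -expRM_natl -expRD ler_expR /r.
by rewrite le_eqVlt; apply/orP; left; apply/eqP; field.
Qed.

End IndependentSampling.

(** * Means with respect to the density *)

Section DensityMean.
Context {R : realType}.
Variables (a b : R) (nu : R -> R).

Definition density_mean (h : R -> R) : R :=
  \int[lebesgue_measure]_(x in `[a, b]) (h x * nu x).

(** This class contains polynomials, continuous functions and indicators, is closed under sums and
    products, and makes [h * nu] integrable, as linearity of the integral requires. *)
Definition bounded_measurable (h : R -> R) : Prop :=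
  measurable_fun `[a, b] h /\ exists M, forall x, x \in `[a, b] -> `|h x| <= M.

Lemma bounded_measurable_cst (c : R) : bounded_measurable (fun=> c).
Proof. by split; [exact: measurable_cst | exists `|c|]. Qed.

Lemma bounded_measurableD f g : bounded_measurable f -> bounded_measurable g ->
  bounded_measurable (fun x => f x + g x).
Proof.
move=> [mf [M hf]] [mg [M' hg]]; split; first exact: measurable_funD.
exists (M + M') => x xab; rewrite (le_trans (ler_normD _ _))//.
by rewrite lerD ?hf ?hg.
Qed.

Lemma bounded_measurableM f g : bounded_measurable f -> bounded_measurable g ->
  bounded_measurable (fun x => f x * g x).
Proof.
move=> [mf [M hf]] [mg [M' hg]]; split; first exact: measurable_funM.
exists (M * M') => x xab; rewrite normrM.
by apply: ler_pM => //; [exact: hf | exact: hg].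
Qed.

Lemma bounded_measurableZ c f : bounded_measurable f ->
  bounded_measurable (fun x => c * f x).
Proof. exact/bounded_measurableM/bounded_measurable_cst. Qed.

Lemma bounded_measurable_sum (I : Type) (r : seq I) (Q : pred I) (F : I -> R -> R) :
  (forall i, Q i -> bounded_measurable (F i)) ->
  bounded_measurable (fun x => \sum_(i <- r | Q i) F i x).
Proof.
move=> hF; elim: r => [|i r IH].
  under eq_fun do rewrite big_nil.
  exact: bounded_measurable_cst.
under eq_fun do rewrite big_cons.
have [Qi|//] := boolP (Q i).
by apply: bounded_measurableD => //; exact: hF.
Qed.

Lemma bounded_measurable_indic (B : set R) : measurable B ->
  bounded_measurable (\1_B).
Proof.
move=> mB; split; first exact: measurable_indic.
exists 1 => x _; rewrite indicE.
by case: (x \in B); rewrite ?normr1 ?normr0.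
Qed.

Lemma bounded_measurable_continuous (f : R -> R) :
  {within `[a, b], continuous f} -> bounded_measurable f.
Proof.
move=> cf; split.
  by apply: subspace_continuous_measurable_fun.
have /compact_bounded[M [_ hM]] := continuous_compact cf (@segment_compact R a b).
exists (M + 1) => x xab; apply: hM; first by rewrite ltrDl.
by exists x.
Qed.

Lemma bounded_measurable_horner (p : {poly R}) : bounded_measurable (horner p).
Proof.
apply: bounded_measurable_continuous; apply: continuous_subspaceT.
exact: continuous_horner.
Qed.

Hypothesis dens : is_density a b nu.

Lemma density_integrable :
  lebesgue_measure.-integrable `[a, b] (EFin \o nu).
Proof.
have [mnu nu0 nu1] := dens; apply/integrableP; split.
  exact/measurable_EFinP.
rewrite [ltLHS](_ : _ = 1%:E) ?ltry// -[RHS]nu1.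
apply: eq_integral => x xab /=.
by rewrite ger0_norm// nu0//; move: xab; rewrite inE.
Qed.

Lemma density_mean_integrable (h : R -> R) : bounded_measurable h ->
  lebesgue_measure.-integrable `[a, b] (EFin \o (fun x => h x * nu x)).
Proof.
move=> [mh [M hM]].
have bh : [bounded h x | x in (`[a, b] : set R)].
  exists M; split; first exact: num_real.
  by move=> M' MM' x xab; apply: le_trans (ltW MM'); exact: hM.
pose mu := @lebesgue_measure R.
have inu : mu.-integrable `[a, b] (EFin \o nu) by exact: density_integrable.
have : mu.-integrable `[a, b] ((EFin \o h) \* (EFin \o nu))%E.
  exact: integrableMr.
by apply: eq_integrable.
Qed.

Lemma density_meanD f g : bounded_measurable f -> bounded_measurable g ->
  density_mean (fun x => f x + g x) = density_mean f + density_mean g.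
Proof.
move=> bf bg; rewrite /density_mean -RintegralD//; [|exact: density_mean_integrable..].
by apply: eq_Rintegral => x _; rewrite mulrDl.
Qed.

Lemma density_meanZ (c : R) f : bounded_measurable f ->
  density_mean (fun x => c * f x) = c * density_mean f.
Proof.
move=> bf; rewrite /density_mean -RintegralZl//; last exact: density_mean_integrable.
by apply: eq_Rintegral => x _; rewrite mulrA.
Qed.

Lemma density_mean_le f g : bounded_measurable f -> bounded_measurable g ->
  (forall x, x \in `[a, b] -> f x <= g x) -> density_mean f <= density_mean g.
Proof.
move=> bf bg fg; have [_ nu0 _] := dens.
apply: le_Rintegral => //; try exact: density_mean_integrable.
by move=> x xab; rewrite ler_wpM2r ?nu0 ?fg.
Qed.

Lemma eq_density_mean f g : (forall x, x \in `[a, b] -> f x = g x) ->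
  density_mean f = density_mean g.
Proof. by move=> fg; apply: eq_Rintegral => x; rewrite inE => xab; rewrite fg. Qed.

Lemma density_mean_cst (c : R) : density_mean (fun=> c) = c.
Proof.
have [mnu nu0 nu1] := dens.
rewrite -[RHS]mulr1 /density_mean RintegralZl//; last exact: density_integrable.
by rewrite /Rintegral nu1.
Qed.

Lemma density_mean_ge0 f : (forall x, x \in `[a, b] -> 0 <= f x) ->
  0 <= density_mean f.
Proof.
move=> f0; have [_ nu0 _] := dens.
by apply: Rintegral_ge0 => x xab; rewrite mulr_ge0 ?f0 ?nu0.
Qed.

Lemma density_mean_sum (I : Type) (r : seq I) (Q : pred I) (F : I -> R -> R) :
  (forall i, Q i -> bounded_measurable (F i)) ->
  density_mean (fun x => \sum_(i <- r | Q i) F i x) =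
  \sum_(i <- r | Q i) density_mean (F i).
Proof.
move=> hF; elim: r => [|i r IH].
  rewrite big_nil -[RHS]density_mean_cst.
  by apply: eq_density_mean => x _; rewrite big_nil.
rewrite big_cons -IH.
have [Qi|nQi] := boolP (Q i); last first.
  by apply: eq_density_mean => x _; rewrite big_cons (negbTE nQi).
rewrite -density_meanD; [|exact: hF|exact: bounded_measurable_sum].
by apply: eq_density_mean => x _; rewrite big_cons Qi.
Qed.

Lemma law_density_mean {d : measure_display} {T : measurableType d}
    (P : probability T R) (X : {RV P >-> R}) (B : set R) :
  has_density_on a b nu X -> measurable B ->
  P (X @^-1` B) = (density_mean (\1_B))%:E.
Proof.
move=> hX mB; have /= := hX B mB; rewrite /distribution /pushforward => ->.
rewrite setIC integral_mkcondr /density_mean /Rintegral fineK; last first.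
  apply: integrable_fin_num => //.
  by apply: density_mean_integrable; exact: bounded_measurable_indic.
apply: eq_integral => x _; rewrite /patch indicE.
by case: ifP => _; rewrite ?mul1r ?mul0r.
Qed.

End DensityMean.

(** * Dyadic levels *)

Section Levels.
Context {R : realType}.

Lemma indic_boolE {T : Type} (Q : T -> bool) (x : T) :
  \1_[set u | Q u] x = (Q x)%:R :> R.
Proof. by rewrite indicE; congr ((nat_of_bool _)%:R); apply/idP/idP; rewrite inE. Qed.

(** First-moment method: if every [F i] exceeded [c], the nonnegative terms [w i * (F i - c)] would
    sum to at most 0, so all weights would vanish. *)
Lemma exists_le_average (I : finType) (w F : I -> R) (c : R) :
  (forall i, 0 <= w i) -> \sum_i w i = 1 -> \sum_i w i * F i <= c ->
  exists i, F i <= c.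
Proof.
move=> w0 w1 wF; apply: contrapT => /forallNP hF.
have Fc i : c < F i by rewrite ltNge; apply/negP; exact: hF.
have t0 i : 0 <= w i * (F i - c) by rewrite mulr_ge0// subr_ge0 ltW.
have s0 : \sum_i w i * (F i - c) = 0.
  apply/eqP; rewrite eq_le sumr_ge0// andbT.
  under eq_bigr do rewrite mulrBr.
  by rewrite big_split /= sumrN -mulr_suml w1 mul1r subr_le0.
have wz i : w i = 0.
  have := psumr_eq0P (fun i _ => t0 i) s0; move=> /(_ i isT) /eqP.
  by rewrite mulf_eq0 subr_eq0 [F i == c]gt_eqF// orbF => /eqP.
by move: w1; rewrite big1// => /eqP; rewrite eq_sym oner_eq0.
Qed.

(** If [x] reaches the new level, the new term [4 * 4^-(n+1)] equals the old remainder [4^-n] and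
    replaces it; otherwise [x < 2^-(n+1)] and the new remainder alone dominates [x^2]. *)
Lemma square_le_levels (n : nat) (x : R) : 0 <= x <= 1 ->
  x ^+ 2 <= 4^-1 ^+ n +
    \sum_(j < n) 4 * (4^-1 ^+ j.+1 * (2^-1 ^+ j.+1 <= x)%R%:R).
Proof.
move=> /andP[x0 x1]; elim: n => [|n IH].
  by rewrite big_ord0 expr0 addr0 expr_le1.
have e4 : (4^-1 : R) = 2^-1 ^+ 2 by rewrite expr2; field.
rewrite big_ord_recr /=; set S := \sum_(_ < _) _ in IH *.
have S0 : 0 <= S.
  apply: sumr_ge0 => j _; rewrite !mulr_ge0 ?exprn_ge0//.
case: (leP (2^-1 ^+ n.+1) x) => h; rewrite ?mulr1 ?mulr0 ?addr0.
  rewrite (le_trans IH)// exprS; have : 0 <= 4^-1 ^+ n :> R by rewrite exprn_ge0.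
  by lra.
apply: (@le_trans _ _ (4^-1 ^+ n.+1)); last by rewrite lerDl.
by rewrite e4 -exprM mulnC exprM lerXn2r ?nnegrE ?exprn_ge0// ltW.
Qed.

(** The levels reached form a geometric series dominated by its first term, which is at most
    [4 x^2]; the ratio contributes [4/3]. Thresholds are halved because passing from the true to the
    empirical measure loses a factor 2. *)
Lemma levels_le_square (n : nat) (x : R) : 0 <= x ->
  \sum_(j < n) 4^-1 ^+ j.+1 * (2^-1 * 2^-1 ^+ j.+1 <= x)%R%:R <= 16 / 3 * x ^+ 2.
Proof.
move=> x0.
have e4 k : (4^-1 ^+ k : R) = (2^-1 ^+ k) ^+ 2.
  by rewrite exprAC; congr (_ ^+ _); rewrite expr2; field.
pose S k := \sum_(j < k) 4^-1 ^+ j.+1 * (2^-1 * 2^-1 ^+ j.+1 <= x)%R%:R : R.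
(* The invariant for the induction: once a level is reached, the tail [4^-n / 3] of the geometric
   series is kept in reserve for the terms still to come. *)
suff H : if 2^-1 * 2^-1 ^+ n <= x
   then (S n <= 16 / 3 * x ^+ 2 - 3^-1 * 4^-1 ^+ n : Prop) else S n = 0.
  rewrite -/(S n).
  move: H; case: ifP => _ H.
    by rewrite (le_trans H)// gerBl mulr_ge0// exprn_ge0.
  by rewrite H mulr_ge0 ?sqr_ge0.
elim: n => [|n IH].
  rewrite /S !big_ord0 !expr0 mulr1; case: (leP 2^-1 x) => // h.
  have : 0 <= (x - 2^-1) * (x + 2^-1) by rewrite mulr_ge0//; lra.
  by rewrite expr2; lra.
have -> : S n.+1 = S n + 4^-1 ^+ n.+1 * (2^-1 * 2^-1 ^+ n.+1 <= x)%R%:R.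
  by rewrite /S big_ord_recr.
have u0 : 0 < 2^-1 ^+ n :> R by rewrite exprn_gt0.
move: IH; rewrite !e4 ![2^-1 ^+ _.+1]exprS; set u := 2^-1 ^+ n in u0 *.
case: (leP (2^-1 * u) x) => h1; case: (leP (2^-1 * (2^-1 * u)) x) => h2 /= IH; rewrite ?mulr1 ?mulr0 ?addr0 //.
- by move: IH; rewrite !expr2; lra.
- by exfalso; lra.
- rewrite IH add0r.
  have : 0 <= (x - 2^-1 * (2^-1 * u)) * (x + 2^-1 * (2^-1 * u)).
    by rewrite mulr_ge0//; lra.
  by rewrite !expr2; lra.
Qed.

Lemma sum_inv_consecutive (n : nat) :
  \sum_(j < n) ((j.+1%:R * j.+2%:R)^-1 : R) <= 1.
Proof.
have -> : \sum_(j < n) ((j.+1%:R * j.+2%:R)^-1 : R) = 1 - n.+1%:R^-1.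
  elim: n => [|n IH]; first by rewrite big_ord0 invr1 subrr.
  rewrite big_ord_recr /= IH.
  have h1 : n.+1%:R != 0 :> R by rewrite pnatr_eq0.
  have h2 : n.+2%:R != 0 :> R by rewrite pnatr_eq0.
  have e2 : n.+2%:R = n.+1%:R + 1 :> R by rewrite -natr1.
  rewrite e2 in h2 *; move: (n.+1%:R : R) h1 h2 => z h1 h2.
  by field; rewrite h1 h2.
by rewrite gerBl invr_ge0.
Qed.

End Levels.

(** * Uniform lower bound over the convex hull *)

Section GoodSample.
Context {R : realType} {D : finType}.
Variables (a b : R) (nu : R -> R) (phi : D -> R -> R).
Hypothesis dens : is_density a b nu.
Hypothesis phi_measurable : forall d, measurable_fun setT (phi d).
Hypothesis phi_le1 : forall d u, `|phi d u| <= 1.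

Definition hull (lam : D -> R) (u : R) : R := \sum_d lam d * phi d u.

Definition dictionary_average q (J : {ffun 'I_q -> D}) (u : R) : R :=
  q%:R^-1 * \sum_l phi (J l) u.

Definition superlevel (c : R) (g : R -> R) : set R := [set u | c <= `|g u|].

Lemma measurable_hull lam : measurable_fun setT (hull lam).
Proof.
by apply: measurable_sum => d; apply: measurable_funM.
Qed.

Lemma measurable_dictionary_average q (J : {ffun 'I_q -> D}) :
  measurable_fun setT (dictionary_average J).
Proof. by apply: measurable_funM => //; apply: measurable_sum. Qed.

Lemma measurable_superlevel c (g : R -> R) : measurable_fun setT g ->
  measurable (superlevel c g).
Proof.
move=> mg.
have -> : superlevel c g = setT `&` (fun u => `|g u|) @^-1` `[c, +oo[%classic.
  by rewrite setTI; apply/seteqP; split=> u; rewrite /superlevel /= in_itv /= andbT.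
have mn : measurable_fun setT (fun u => `|g u|) by exact: measurableT_comp.
exact: mn.
Qed.

Definition empirical_mean m (x : 'I_m -> R) (h : R -> R) : R :=
  m%:R^-1 * \sum_i h (x i).

Lemma empirical_mean_le m (x : 'I_m -> R) h1 h2 :
  (forall u, h1 u <= h2 u) -> empirical_mean x h1 <= empirical_mean x h2.
Proof. by move=> h12; rewrite ler_wpM2l ?invr_ge0//; apply: ler_sum => i _. Qed.

Lemma empirical_meanD m (x : 'I_m -> R) h1 h2 :
  empirical_mean x (fun u => h1 u + h2 u) = empirical_mean x h1 + empirical_mean x h2.
Proof. by rewrite /empirical_mean big_split mulrDr. Qed.

Lemma empirical_meanZ m (x : 'I_m -> R) c h :
  empirical_mean x (fun u => c * h u) = c * empirical_mean x h.
Proof. by rewrite /empirical_mean -mulr_sumr mulrCA. Qed.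

Lemma empirical_mean_sum m (x : 'I_m -> R) (I : finType) (F : I -> R -> R) :
  empirical_mean x (fun u => \sum_i F i u) = \sum_i empirical_mean x (F i).
Proof. by rewrite /empirical_mean exchange_big /= mulr_sumr. Qed.

(** Equality fails only for [m = 0], where the inverse of 0 is 0 and the empirical mean vanishes. *)
Lemma empirical_mean_cst_le m (x : 'I_m -> R) c : 0 <= c ->
  empirical_mean x (fun=> c) <= c.
Proof.
move=> c0; rewrite /empirical_mean sumr_const card_ord -[c *+ m]mulr_natl mulrA.
have [->|m0] := eqVneq m 0%N; first by rewrite mulr0 mul0r.
by rewrite mulVf ?mul1r// pnatr_eq0.
Qed.

Lemma empirical_mean_ge0 m (x : 'I_m -> R) h :
  (forall u, 0 <= h u) -> 0 <= empirical_mean x h.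
Proof. by move=> h0; rewrite mulr_ge0 ?invr_ge0//; apply: sumr_ge0. Qed.

Section Simplex.
Variable lam : D -> R.
Hypothesis lam_ge0 : forall d, 0 <= lam d.
Hypothesis lam_sum : \sum_d lam d = 1.

Definition deviation_set q (J : {ffun 'I_q -> D}) (tau : R) : set R :=
  [set u | tau < `|dictionary_average J u - hull lam u|].

Lemma measurable_deviation_set q (J : {ffun 'I_q -> D}) tau :
  measurable (deviation_set J tau).
Proof.
have -> : deviation_set J tau = setT `&`
    (fun u => `|dictionary_average J u - hull lam u|) @^-1` `]tau, +oo[%classic.
  by rewrite setTI; apply/seteqP; split=> u; rewrite /deviation_set /= in_itv /= andbT.
have mn : measurable_fun setT (fun u => `|dictionary_average J u - hull lam u|).
  apply: measurableT_comp => //.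
  by apply: measurable_funB; [exact: measurable_dictionary_average|exact: measurable_hull].
exact: mn.
Qed.

(* The empirical and the true measure are averaged over the same random
   dictionary average, so a single one is close to the hull function for both. *)
Lemma maurey_approximation m (x : 'I_m -> R) (q : nat) (tau e : R) : (0 < q)%N ->
  0 <= tau <= 4 -> 2 * expR (- (q%:R * tau ^+ 2 / 32)) <= e ->
  exists J : {ffun 'I_q -> D},
    density_mean a b nu (\1_(deviation_set J tau)) +
    empirical_mean x (\1_(deviation_set J tau)) <= 2 * e.
Proof.
move=> q0 tau04 he.
pose w (J : {ffun 'I_q -> D}) := \prod_l lam (J l).
have w0 J : 0 <= w J by exact: prodr_ge0.
have w1 : \sum_J w J = 1.
  rewrite -(bigA_distr_bigA (fun (l : 'I_q) d => lam d)) /=.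
  by rewrite big1// => i _.
apply: (exists_le_average w0 w1).
have pt u : \sum_J w J * \1_(deviation_set J tau) u <= e.
  apply: le_trans he; apply: le_trans (@maurey_tail _ _ _ lam_ge0 lam_sum q (phi^~ u) tau q0 _ tau04).
    by apply: ler_sum => J _; rewrite /deviation_set indic_boolE lexx.
  by move=> d; exact: phi_le1.
have bw J : bounded_measurable a b (fun u => w J * \1_(deviation_set J tau) u).
  apply: bounded_measurableM; first exact: bounded_measurable_cst.
  by apply: bounded_measurable_indic; exact: measurable_deviation_set.
under eq_bigr do rewrite mulrDr.
rewrite big_split /= mulrDl mul1r lerD//.
  rewrite -[leRHS](density_mean_cst dens).
  under eq_bigr => J _.
    rewrite -(density_meanZ dens); last first.
      by apply: bounded_measurable_indic; exact: measurable_deviation_set.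
    over.
  rewrite -density_mean_sum//; apply: density_mean_le => //.
    exact: bounded_measurable_sum.
  exact: bounded_measurable_cst.
under eq_bigr do rewrite -empirical_meanZ.
rewrite -empirical_mean_sum.
apply: (le_trans (empirical_mean_le x pt)); apply: empirical_mean_cst_le.
by rewrite (le_trans _ he)// mulr_ge0 ?expR_ge0.
Qed.

(** Outside a deviation set of tolerance [t / 4], a hull value above [t] forces the dictionary
    average above [3 t / 4], which in turn forces the hull value above [t / 2]. The true and
    empirical masses of the deviation set add up to at most [kap / 16 <= p / 16], which leaves
    [p / 8] out of [p / 4]. *)
Lemma level_transfer m (x : 'I_m -> R) (q : nat) (t kap : R) : (0 < q)%N ->
  0 <= t <= 1 -> 2 * expR (- (q%:R * (t / 4) ^+ 2 / 32)) <= kap / 32 ->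
  (forall J : {ffun 'I_q -> D},
     let p := density_mean a b nu (\1_(superlevel (3 / 4 * t) (dictionary_average J))) in
     kap / 2 <= p ->
     p / 4 <= empirical_mean x (\1_(superlevel (3 / 4 * t) (dictionary_average J)))) ->
  let p := density_mean a b nu (\1_(superlevel t (hull lam))) in
  kap <= p -> p / 8 <= empirical_mean x (\1_(superlevel (2^-1 * t) (hull lam))).
Proof.
move=> q0 t01 he good p kp.
have t4 : 0 <= t / 4 <= 4 by lra.
have [J hJ] := maurey_approximation x q0 t4 he.
have := good J; set bad := deviation_set J (t / 4) in hJ *.
set h := dictionary_average J; move=> /=.
set p' := density_mean _ _ _ _; set e' := empirical_mean _ _ => goodJ.
have near u : ~~ (t / 4 < `|h u - hull lam u|) ->
    `|h u| <= `|hull lam u| + t / 4 /\ `|hull lam u| <= `|h u| + t / 4.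
  rewrite -leNgt => hu.
  have h1 := ler_normD (h u - hull lam u) (hull lam u); rewrite subrK in h1.
  have h2 := ler_normB (h u) (h u - hull lam u); rewrite subKr in h2.
  by split; lra.
have c1 u : \1_(superlevel t (hull lam)) u <=
    \1_(superlevel (3 / 4 * t) h) u + \1_bad u :> R.
  rewrite /superlevel /bad /deviation_set -/h !indic_boolE.
  have := near u; case: (t / 4 < `|h u - hull lam u|) => /= [_|/(_ isT)[n1 n2]].
    by case: (t <= `|hull lam u|); case: (3 / 4 * t <= `|h u|) => /=; lra.
  by case: (leP t `|hull lam u|) => h1; case: (leP (3 / 4 * t) `|h u|) => h2 //=; lra.
have c2 u : \1_(superlevel (3 / 4 * t) h) u <=
    \1_(superlevel (2^-1 * t) (hull lam)) u + \1_bad u :> R.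
  rewrite /superlevel /bad /deviation_set -/h !indic_boolE.
  have := near u; case: (t / 4 < `|h u - hull lam u|) => /= [_|/(_ isT)[n1 n2]].
    by case: (3 / 4 * t <= `|h u|); case: (2^-1 * t <= `|hull lam u|) => /=; lra.
  by case: (leP (3 / 4 * t) `|h u|) => h1; case: (leP (2^-1 * t) `|hull lam u|) => h2 //=; lra.
have mh : measurable_fun setT h by exact: measurable_dictionary_average.
have bsup c g : measurable_fun setT g ->
    bounded_measurable a b (\1_(superlevel c g)).
  by move=> mg; apply: bounded_measurable_indic; exact: measurable_superlevel.
have bbad : bounded_measurable a b (\1_bad).
  by apply: bounded_measurable_indic; exact: measurable_deviation_set.
have l1 : p <= p' + density_mean a b nu (\1_bad).
  rewrite -density_meanD//; last exact: bsup.
  apply: density_mean_le => //; first by apply: bsup; exact: measurable_hull.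
  by apply: bounded_measurableD => //; exact: bsup.
have l2 : e' <= empirical_mean x (\1_(superlevel (2^-1 * t) (hull lam))) +
    empirical_mean x (\1_bad).
  by rewrite -empirical_meanD; exact: empirical_mean_le.
have b0 : 0 <= density_mean a b nu (\1_bad).
  by apply: density_mean_ge0 => // u _; rewrite indicE.
have b1 : 0 <= empirical_mean x (\1_bad).
  by apply: empirical_mean_ge0 => u; rewrite indicE.
have kp' : kap / 2 <= p' by lra.
have := goodJ kp'; lra.
Qed.

(* The thresholds [kap j] are summable against the weights [4^-(j+1)], so that
   the levels below threshold lose only a fraction of [rho], while [kap j] stays
   above a multiple of [rho], which yields the failure probability exp(-c m/s). *)
Lemma sample_lower_bound m (x : 'I_m -> R) (n : nat) (q : nat -> nat) (rho : R) :
  (forall j, 0 < q j)%N -> 4^-1 ^+ n <= rho / 4 ->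
  let kap j := rho * 4 ^+ j.+1 / (16 * (j.+1%:R * j.+2%:R)) in
  (forall j, (j < n)%N ->
     2 * expR (- ((q j)%:R * (2^-1 ^+ j.+1 / 4) ^+ 2 / 32)) <= kap j / 32) ->
  (forall j, (j < n)%N -> forall J : {ffun 'I_(q j) -> D},
     let p := density_mean a b nu
       (\1_(superlevel (3 / 4 * 2^-1 ^+ j.+1) (dictionary_average J))) in
     kap j / 2 <= p ->
     p / 4 <= empirical_mean x
       (\1_(superlevel (3 / 4 * 2^-1 ^+ j.+1) (dictionary_average J)))) ->
  rho <= density_mean a b nu (fun u => hull lam u ^+ 2) ->
  rho * (3 / 1024) <= empirical_mean x (fun u => hull lam u ^+ 2).
Proof.
move=> q0 hn kap hq good hrho.
pose t j : R := 2^-1 ^+ j.+1; pose c j : R := 4^-1 ^+ j.+1.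
have c0 j : 0 <= c j by rewrite exprn_ge0.
pose p j := density_mean a b nu (\1_(superlevel (t j) (hull lam))).
pose e j := empirical_mean x (\1_(superlevel (2^-1 * t j) (hull lam))).
have e0 j : 0 <= e j by apply: empirical_mean_ge0 => u; rewrite indicE.
have rho0 : 0 <= rho.
  have p4 : 0 <= 4^-1 ^+ n :> R by rewrite exprn_ge0.
  lra.
have mhull : measurable_fun setT (hull lam) by exact: measurable_hull.
have hull1 u : `|hull lam u| <= 1.
  by apply: (mean_le1 lam_ge0 lam_sum) => d; exact: phi_le1.
have bhull : bounded_measurable a b (hull lam).
  split; last by exists 1.
  exact: measurable_funTS.
have bsup s : bounded_measurable a b (\1_(superlevel s (hull lam))).
  by apply: bounded_measurable_indic; exact: measurable_superlevel.
have bterm j : bounded_measurable a b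
    (fun u => 4 * (c j * \1_(superlevel (t j) (hull lam)) u)).
  by apply/bounded_measurableZ/bounded_measurableZ/bsup.
have up : rho <= 4^-1 ^+ n + \sum_(j < n) 4 * (c j * p j).
  apply: (le_trans hrho).
  have -> : \sum_(j < n) 4 * (c j * p j) = density_mean a b nu (fun u =>
      \sum_(j < n) 4 * (c j * \1_(superlevel (t j) (hull lam)) u)).
    rewrite (density_mean_sum dens)//; apply: eq_bigr => j _.
    rewrite (density_meanZ dens) ?(density_meanZ dens)//.
    exact/bounded_measurableZ/bsup.
  rewrite -[4^-1 ^+ n](density_mean_cst dens) -density_meanD//; first last.
  - by apply: bounded_measurable_sum.
  - exact: bounded_measurable_cst.
  apply: density_mean_le => //.
  - exact: (bounded_measurableM bhull bhull).
  - apply: bounded_measurableD; first exact: bounded_measurable_cst.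
    by apply: bounded_measurable_sum.
  move=> u _; rewrite -real_normK ?num_real//.
  apply: (le_trans (@square_le_levels _ n `|hull lam u| _)).
    by rewrite normr_ge0 hull1.
  by rewrite lerD2l; apply: ler_sum => j _; rewrite /superlevel indic_boolE.
have down : \sum_(j < n) c j * e j <= 16 / 3 * empirical_mean x (fun u => hull lam u ^+ 2).
  rewrite -empirical_meanZ.
  under eq_bigr do rewrite -empirical_meanZ.
  rewrite -empirical_mean_sum; apply: empirical_mean_le => u.
  rewrite -[_ ^+ 2]real_normK ?num_real//.
  apply: le_trans (levels_le_square n (normr_ge0 _)).
  by apply: ler_sum => j _; rewrite /superlevel indic_boolE.
(* Above the threshold [kap j] the level transfers to the sample; below it, [c j * p j] is at most
   [c j * kap j], which is the second summand. *)
have level (j : 'I_n) : c j * p j <= 8 * (c j * e j) +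
    rho / 16 * (j.+1%:R * j.+2%:R)^-1.
  have z0 : 0 < j.+1%:R * j.+2%:R :> R by rewrite mulr_gt0// ltr0n.
  have kc : c j * kap j = rho / 16 * (j.+1%:R * j.+2%:R)^-1.
    rewrite /c /kap exprVn; set z := _ * _ in z0 *.
    have : 4 ^+ j.+1 != 0 :> R by rewrite expf_neq0// pnatr_eq0.
    by move=> h4; field; rewrite h4 gt_eqF.
  have [kp|kp] := leP (kap j) (p j).
    have lt := @level_transfer m x (q j) (t j) (kap j) (q0 j).
    have t01 : 0 <= t j <= 1.
      by rewrite exprn_ge0// exprn_ile1//; lra.
    have := lt t01 (hq j (ltn_ord j)) (good j (ltn_ord j)) kp.
    rewrite -/(p j) -/(e j) => pe.
    have h1 : c j * (p j / 8) <= c j * e j by rewrite ler_wpM2l.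
    have h2 : 0 <= rho / 16 * (j.+1%:R * j.+2%:R)^-1.
      by rewrite mulr_ge0 ?divr_ge0// invr_ge0 ltW.
    move: h1 h2; move: (c j) (p j) (e j) (_ / _ * _) => C Q E W; lra.
  rewrite -kc; apply: (@le_trans _ _ (c j * kap j)); first by rewrite ler_wpM2l//; exact: ltW.
  by rewrite lerDr mulr_ge0// mulr_ge0.
have sumlevel : \sum_(j < n) c j * p j <= 8 * (\sum_(j < n) c j * e j) + rho / 16.
  apply: (le_trans (ler_sum _ (fun j _ => level j))).
  rewrite big_split /= -!mulr_sumr lerD2l.
  rewrite -[leRHS]mulr1 ler_wpM2l ?divr_ge0//.
  exact: sum_inv_consecutive.
rewrite -mulr_sumr in up.
(* The remainder [rho / 4] in [up] leaves [A >= 3 rho / 16]; then [sumlevel] gives [B >= rho / 64],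
   and the factor [16 / 3] in [down] yields [3 rho / 1024]. *)
move: up down sumlevel; set A := \sum_(_ < _) _; set B := \sum_(_ < _) _.
by move=> up down sumlevel; lra.
Qed.

End Simplex.
End GoodSample.

(** * The good sampling event and its probability *)

Section SamplingEvent.
Context {R : realType} {D : finType} {d : measure_display} {T : measurableType d}.
Variables (a b : R) (nu : R -> R) (phi : D -> R -> R) (P : probability T R).
Hypothesis dens : is_density a b nu.
Hypothesis phi_measurable : forall d, measurable_fun setT (phi d).
Hypothesis phi_le1 : forall d u, `|phi d u| <= 1.
Variables (m : nat) (X : 'I_m -> {RV P >-> R}).
Hypothesis m0 : (0 < m)%N.
Hypothesis indepX : mutually_independent X.
Hypothesis lawX : forall j, has_density_on a b nu (X j).

(** This keeps the threshold [kap j] of every level at least [rho / 8]. *)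
Lemma pow4_ge_consecutive (k : nat) : 2 * (k.+1%:R * k.+2%:R) <= 4 ^+ k.+1 :> R.
Proof.
elim: k => [|k IH]; first by lra.
rewrite exprS; move: IH; rewrite -!natr1; have : 0 <= k%:R :> R by [].
by move: (k%:R : R) (4 ^+ k.+1 : R) => x y; nra.
Qed.

Lemma probability_out_of_range i : P (X i @^-1` (~` `[a, b])) = 0%E.
Proof.
have mab : measurable (~` `[a, b] : set R) by exact: measurableC.
rewrite (law_density_mean dens (lawX i) mab); congr (_%:E).
rewrite -[RHS](density_mean_cst dens 0); apply: eq_density_mean => x xab.
by rewrite indicE memNset//=; apply/negP; rewrite negbK.
Qed.

(** Union bound over the levels [j < n] and the [#|D| ^ q j] tuples at each level. A tuple with
    [p j J >= kap j / 2] fails with probability at most [exp (- m kap j / 8)]. Half of this exponent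
    pays for the number of tuples; the other half is at least [m / (2048 s)]. The event depends on
    tuples only, hence serves all [lam] at once. *)
Lemma sampling_event (s n r : nat) : (0 < s)%N -> (0 < r)%N -> (0 < #|D|)%N ->
  4^-1 ^+ n <= (16 * s%:R)^-1 / 4 :> R ->
  2 * expR (- r%:R) <= (4096 * s%:R)^-1 :> R ->
  2 ^+ 21 * s%:R * r%:R * (n%:R * n.+1%:R) * ln #|D|%:R <= m%:R :> R ->
  exists E : set T, [/\ measurable E,
    ((1 - n%:R * expR (- (m%:R / (2048 * s%:R))))%:E <= P E)%E &
    forall t, E t -> (forall i, X i t \in `[a, b]) /\
      forall lam : D -> R, (forall d, 0 <= lam d) -> \sum_d lam d = 1 ->
      (16 * s%:R)^-1 <= density_mean a b nu (fun u => hull phi lam u ^+ 2) ->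
      (16 * s%:R)^-1 * (3 / 1024) <=
        empirical_mean (fun i => X i t) (fun u => hull phi lam u ^+ 2)].
Proof.
move=> s0 r0 D0 hn hr hm.
have s0' : 0 < s%:R :> R by rewrite ltr0n.
pose rho : R := (16 * s%:R)^-1.
have rhoE : rho = 16^-1 * s%:R^-1 by rewrite /rho invfM.
(* With [t = 2^-(j+1)] the exponent [q (t / 4)^2 / 32] of Maurey's bound becomes exactly [r]. *)
pose q j := (512 * 4 ^ j.+1 * r)%N.
have q0 j : (0 < q j)%N by rewrite /q !muln_gt0 expn_gt0 r0.
pose kap j : R := rho * 4 ^+ j.+1 / (16 * (j.+1%:R * j.+2%:R)).
have kap_ge j : rho / 8 <= kap j.
  have z0 : 0 < j.+1%:R * j.+2%:R :> R by rewrite mulr_gt0// ltr0n.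
  rewrite /kap ler_pdivlMr; last by lra.
  have := pow4_ge_consecutive j.
  have : 0 < rho by rewrite invr_gt0; lra.
  by move: (_ * _) (4 ^+ _) z0 => z y; nra.
pose B j (J : {ffun 'I_(q j) -> D}) :=
  superlevel (3 / 4 * 2^-1 ^+ j.+1) (dictionary_average phi J).
pose p j J := density_mean a b nu (\1_(@B j J)).
have mB j J : measurable (@B j J).
  by apply: measurable_superlevel; exact: measurable_dictionary_average.
pose low j J := [set t | \sum_i \1_(@B j J) (X i t) < m%:R * @p j J / 4].
have lowP j J : measurable (@low j J) /\
    (P (@low j J) <= (expR (- (m%:R * @p j J / 4)))%:E)%E.
  apply: count_lower_tail => // i.
  exact: (law_density_mean dens (lawX i)).
pose lowj j := \big[setU/set0]_(J : {ffun 'I_(q j) -> D} | kap j / 2 <= p j J) low j J.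
have mlowj j : measurable (lowj j).
  by apply: measurable_bigsetU => J _; case: (lowP j J).
pose badlow := \big[setU/set0]_(j < n) lowj j.
(* The law places the samples in the interval only almost surely; the exceptional null event is
   removed as well. *)
pose badout := \big[setU/set0]_(i < m) (X i @^-1` (~` `[a, b])).
have mout i : measurable (X i @^-1` (~` `[a, b])).
  by apply: measurable_preimage_RV; exact: measurableC.
have mbadlow : measurable badlow by apply: measurable_bigsetU.
have mbadout : measurable badout by apply: measurable_bigsetU.
have Plowj (j : 'I_n) : (P (lowj j) <= (expR (- (m%:R / (2048 * s%:R))))%:E)%E.
  apply: (@le_trans _ _ (\sum_(J : {ffun 'I_(q j) -> D} | kap j / 2 <= p j J)
      expR (- (m%:R * kap j / 8)))%:E).
    apply: finite_union_bound => J hJ; first by case: (lowP j J).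
    apply: (le_trans (lowP j J).2); rewrite lee_fin ler_expR lerN2.
    by rewrite -[leLHS]mulrA -[leRHS]mulrA ler_wpM2l//; lra.
  rewrite lee_fin.
  apply: (@le_trans _ _ (\sum_(J : {ffun 'I_(q j) -> D})
      expR (- (m%:R * kap j / 8)))).
    rewrite big_mkcond; apply: ler_sum => J _.
    by case: ifP => // _; exact: expR_ge0.
  rewrite sumr_const card_ffun card_ord.
  rewrite -[leLHS]mulr_natl natrX -[#|D|%:R]lnK ?posrE ?ltr0n//.
  rewrite -expRM_natl -expRD ler_expR.
  have hk : m%:R / (2048 * s%:R) <= m%:R * kap j / 16.
    rewrite -[leRHS]mulrA ler_wpM2l//; have := kap_ge j; rewrite rhoE invfM.
    by move: (s%:R^-1) => z; lra.
  (* The factor 512 of [q j] times the [16^3] in the denominator of [kap j / 16] is the constant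
     [2 ^ 21]. *)
  suff hq : (q j)%:R * ln #|D|%:R <= m%:R * kap j / 16 by lra.
  have z0 : 0 < j.+1%:R * j.+2%:R :> R by rewrite mulr_gt0// ltr0n.
  have zn : j.+1%:R * j.+2%:R <= n%:R * n.+1%:R :> R.
    by rewrite -!natrM ler_nat; apply: leq_mul; exact: (ltn_ord j).
  have lnD : 0 <= ln #|D|%:R :> R by rewrite ln_ge0// ler1n.
  have hm' : 2 ^+ 21 * s%:R * r%:R * (j.+1%:R * j.+2%:R) * ln #|D|%:R <= m%:R :> R.
    by apply: le_trans hm; apply: ler_wpM2r => //; apply: ler_wpM2l.
  rewrite /q /kap !natrM natrX rhoE.
  have -> : m%:R * (16^-1 / s%:R * 4 ^+ j.+1 / (16 * (j.+1%:R * j.+2%:R))) / 16 =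
     4 ^+ j.+1 / (4096 * s%:R * (j.+1%:R * j.+2%:R)) * m%:R :> R.
    move: (_ * _) z0 (4 ^+ _) => z z0 y; field.
    by rewrite !gt_eqF.
  have y0 : 0 < 4 ^+ j.+1 :> R by rewrite exprn_gt0.
  apply: (@le_trans _ _ (4 ^+ j.+1 / (4096 * s%:R * (j.+1%:R * j.+2%:R)) *
    (2 ^+ 21 * s%:R * r%:R * (j.+1%:R * j.+2%:R) * ln #|D|%:R))); last first.
    have c0 : 0 < 4096 :> R by lra.
    apply: ler_wpM2l; last exact: hm'.
    apply: divr_ge0; first exact: ltW.
    exact/ltW/mulr_gt0/z0/mulr_gt0/s0'/c0.
  rewrite le_eqVlt; apply/orP; left; apply/eqP.
  move: (j.+1%:R * j.+2%:R) z0 (4 ^+ _) (ln _) => z z0 y l; field.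
  by rewrite !gt_eqF.
have Plow : (P badlow <= (n%:R * expR (- (m%:R / (2048 * s%:R))))%:E)%E.
  have -> : n%:R * expR (- (m%:R / (2048 * s%:R))) =
      \sum_(j < n) expR (- (m%:R / (2048 * s%:R))) :> R.
    by rewrite sumr_const card_ord -[RHS]mulr_natl.
  exact: finite_union_bound.
have Pout : (P badout <= 0%:E)%E.
  have -> : 0 = \sum_(i < m) 0 :> R by rewrite big1.
  by apply: finite_union_bound => // i _; rewrite probability_out_of_range.
exists (~` (badlow `|` badout)); split.
- by apply: measurableC; exact: measurableU.
- rewrite probability_setC; last exact: measurableU.
  rewrite EFinB leeB//; apply: (le_trans (measureU2 _ mbadlow mbadout)).
  by rewrite -[leRHS]adde0; exact: leeD.
- have notin (I : finType) (Q : pred I) (F : I -> set T) t :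
      ~ (\big[setU/set0]_(i | Q i) F i) t -> forall i, Q i -> ~ F i t.
    by move=> h i Qi Fi; apply: h; rewrite (bigD1 i)//=; left.
  move=> t /not_orP[hlow hout]; split.
    move=> i; have := notin _ _ _ _ hout i isT.
    by rewrite /= => /contrapT.
  move=> lam lam0 lam1 hrho.
  apply: (@sample_lower_bound R D a b nu phi dens phi_measurable phi_le1 lam lam0 lam1
    m (fun i => X i t) n q rho q0 hn) => //.
    move=> j jn.
    have -> : (q j)%:R * (2^-1 ^+ j.+1 / 4) ^+ 2 / 32 = r%:R :> R.
      rewrite /q !natrM natrX expr_div_n -exprM mulnC exprM.
      have -> : (2^-1 ^+ 2 : R) = 4^-1 by rewrite expr2; field.
      rewrite exprVn; have : 4 ^+ j.+1 != 0 :> R by rewrite expf_neq0// pnatr_eq0.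
      by move: (4 ^+ _) => y y0; field.
    rewrite -/(kap j); apply: (le_trans hr); have := kap_ge j.
    by rewrite rhoE invfM; move: (s%:R^-1) => z; lra.
  move=> j jn J pJ; rewrite -/(B j J) /pJ -/(p j J) -/(kap j) => hp.
  have := notin _ _ _ _ (notin _ _ _ _ hlow (Ordinal jn) isT) J hp.
  move=> /negP; rewrite -leNgt => hlt.
  rewrite /empirical_mean ler_pdivlMl ?ltr0n//.
  by rewrite mulrA.
Qed.

End SamplingEvent.

(** * Numerical parameters *)

Section SampleSize.
Context {R : realType}.

Lemma ln2_ge_half : 2^-1 <= ln 2 :> R.
Proof.
rewrite -ler_expR lnK ?posrE//; apply: (le_trans (expR_le_quadratic _)).
  by rewrite ger0_norm.
by rewrite expr2; lra.
Qed.

Lemma pow2_le_expR (k : nat) : 2 ^+ k <= expR k%:R :> R.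
Proof.
rewrite -[k%:R]mulr1 expRM_natl lerXn2r ?nnegrE ?expR_ge0//.
by have := expR_ge1Dx (1 : R); lra.
Qed.

Lemma trunc_log_le_ln (s : nat) : (0 < s)%N -> (trunc_log 2 s)%:R <= 2 * ln s%:R :> R.
Proof.
move=> s0; have := ln2_ge_half.
have : ln (2 ^+ trunc_log 2 s) <= ln s%:R :> R.
  by rewrite ler_ln ?posrE ?ltr0n ?exprn_gt0// -natrX ler_nat trunc_logP.
rewrite lnXn// -[_ *+ _]mulr_natl; have : 0 <= (trunc_log 2 s)%:R :> R by [].
by nra.
Qed.

(** The number of levels that brings the truncation remainder below a quarter of the mean square
    [1 / (16 s)]: with [l] the integer part of the base-2 logarithm,
    [64 s <= 2^(l+7) <= 4^(l+4)]. *)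
Lemma truncation_level (s : nat) : (0 < s)%N ->
  4^-1 ^+ (trunc_log 2 s + 4) <= (16 * s%:R)^-1 / 4 :> R.
Proof.
move=> s0; have s0' : 0 < s%:R :> R by rewrite ltr0n.
have -> : (16 * s%:R)^-1 / 4 = (64 * s%:R)^-1 :> R by field; rewrite gt_eqF.
rewrite exprVn lef_pV2 ?posrE ?exprn_gt0 ?mulr_gt0//.
rewrite -natrX -natrM ler_nat.
have /ltnW := trunc_log_ltn s (isT : 1 < 2)%N; rewrite -(leq_pmul2l (isT : 0 < 64)%N).
move=> /leq_trans; apply.
rewrite -[64%N]/(2 ^ 6)%N -expnD -[4%N in leqRHS]/(2 ^ 2)%N -expnM leq_pexp2l//.
by rewrite mulnDr; set l := trunc_log _ _; lia.
Qed.

(** The target [1 / (4096 s)] is [rho / 8 / 32] for [rho = 1 / (16 s)], hence at most [kap j / 32]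
    at every level. *)
Lemma maurey_error_le (s : nat) : (0 < s)%N ->
  2 * expR (- (trunc_log 2 s + 14)%:R) <= (4096 * s%:R)^-1 :> R.
Proof.
move=> s0; have s0' : 0 < s%:R :> R by rewrite ltr0n.
have c0 : 0 < 4096 :> R by lra.
rewrite expRN -ler_pdivlMl// -[2^-1 * _]invfM lef_pV2 ?posrE ?expR_gt0 ?mulr_gt0//.
apply: le_trans (pow2_le_expR _).
have -> : 2 * (4096 * s%:R) = 2 ^+ 13 * s%:R :> R by ring.
rewrite -!natrX -natrM ler_nat.
have /ltnW := trunc_log_ltn s (isT : 1 < 2)%N.
rewrite -(leq_pmul2l (expn_gt0 2 13)) -expnD => /leq_trans; apply.
by rewrite leq_pexp2l// addnC addSnnS.
Qed.

(** The origin of the cubed logarithm in the sample size: one factor is the Maurey exponent [r], two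
    come from the weights [n (n + 1)] that make the thresholds summable. *)
Lemma levels_cube_le (l L : R) : 1 <= l -> l <= 2 * L ->
  (l + 14) * ((l + 4) * (l + 5)) <= 3600 * L ^+ 3.
Proof.
move=> l1 lL.
apply: (@le_trans _ _ ((15 * l) * ((5 * l) * (6 * l)))).
  by apply: ler_pM; [lra|apply: mulr_ge0; lra|lra|apply: ler_pM; lra].
have : l ^+ 3 <= (2 * L) ^+ 3 by rewrite lerXn2r ?nnegrE//; lra.
by rewrite exprMn !exprS !expr0 => h; lra.
Qed.

(** Used to absorb the number of levels into the exponent of the failure probability;
    [l + 4 <= 10 L] and [L^2 W >= 1/8]. *)
Lemma levels_le_cube (l L W : R) : 1 <= l -> l <= 2 * L -> 2^-1 <= W ->
  l + 4 <= 80 * (L ^+ 3 * W).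
Proof.
move=> l1 lL W2; have L2 : 2^-1 <= L by lra.
apply: (@le_trans _ _ (10 * L)); first by lra.
have h : 4^-1 * 2^-1 <= L ^+ 2 * W by apply: ler_pM => //; rewrite expr2; nra.
by rewrite [L ^+ 3]exprS -mulrA; nra.
Qed.

(** Here [3 s <= s^3], because [s >= 2]. *)
Lemma ln_triple_cube_le (s : nat) : (2 <= s)%N ->
  ln (3 * s%:R) ^+ 3 <= 27 * ln s%:R ^+ 3 :> R.
Proof.
move=> s2; have s2' : 2 <= s%:R :> R by rewrite ler_nat.
move: (s%:R : R) s2' => x x2.
have -> : 27 * ln x ^+ 3 = (3 * ln x) ^+ 3 by rewrite !exprS !expr0; ring.
have ln3 : ln (3 * x) <= 3 * ln x.
  have -> : 3 * ln x = ln (x ^+ 3) by rewrite lnXn ?[RHS]mulr_natl//; lra.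
  rewrite ler_ln ?posrE; [|lra|by rewrite exprn_gt0//; lra].
  by rewrite !exprS expr0; nra.
have ln0 : 0 <= ln (3 * x) by rewrite ln_ge0//; lra.
by rewrite lerXn2r ?nnegrE//; lra.
Qed.

(** [M] stands for [N + 1], and [2 M] for the size of the signed dictionary. The constant 7200 is
    3600 from [levels_cube_le] times 2 from [ln (2 M) <= 2 ln M]. *)
Lemma sample_size_bounds (s m M : nat) : (2 <= s)%N -> (2 <= M)%N ->
  7200 * 2 ^+ 21 * s%:R * ln s%:R ^+ 3 * ln M%:R <= m%:R :> R ->
  let n := (trunc_log 2 s + 4)%N in let r := (trunc_log 2 s + 14)%N in
  2 ^+ 21 * s%:R * r%:R * (n%:R * n.+1%:R) * ln (2 * M)%:R <= m%:R :> R /\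
  n%:R * expR (- (m%:R / (2048 * s%:R))) <= M%:R `^ (- (ln (3 * s%:R) ^+ 3)) :> R.
Proof.
move=> s2 M2 hm n r.
have s0 : (0 < s)%N by exact: leq_trans s2.
have s0' : 0 < s%:R :> R by rewrite ltr0n.
have M0 : (0 < M)%N by exact: leq_trans M2.
pose l : R := (trunc_log 2 s)%:R; pose L : R := ln s%:R; pose W : R := ln M%:R.
have lL : l <= 2 * L by exact: trunc_log_le_ln.
have l1 : 1 <= l by rewrite ler1n trunc_log_gt0.
have ln_half k : (2 <= k)%N -> 2^-1 <= ln k%:R :> R.
  move=> k2; apply: (le_trans ln2_ge_half).
  by rewrite ler_ln ?posrE ?ler_nat ?ltr0n// (leq_trans _ k2).
have W2 : 2^-1 <= W by exact: ln_half.
have W0 : 0 <= W by exact: le_trans W2.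
have nE : n%:R = l + 4 :> R by rewrite natrD.
have n1E : n.+1%:R = l + 5 :> R by rewrite -natr1 nE -addrA natr1.
have rE : r%:R = l + 14 :> R by rewrite natrD.
have c0 : 2048 <= 2 ^+ 21 :> R by clear; lra.
rewrite -/L -/W in hm *.
move: (2 ^+ 21) c0 hm => c c0 hm.
have c1 : 0 <= c by apply: (le_trans _ c0); exact: ler0n.
split.
  apply: le_trans hm.
  have W' : ln (2 * M)%:R <= 2 * W.
    rewrite natrM lnM ?posrE ?ltr0n//.
    by rewrite [leRHS]mulrDl mul1r lerD2r ler_ln ?posrE ?ltr0n ?ler_nat.
  have p3 : r%:R * (n%:R * n.+1%:R) <= 3600 * L ^+ 3.
    by rewrite nE n1E rE; exact: levels_cube_le.
  have -> : 7200 * c * s%:R * L ^+ 3 * W = c * s%:R * (3600 * L ^+ 3 * (2 * W)).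
    by clear; move: (s%:R : R) => x; ring.
  rewrite -[c * s%:R * r%:R * _]mulrA -[c * s%:R * _ * ln _]mulrA.
  apply: ler_wpM2l; first exact: mulr_ge0.
  apply: ler_pM => //.
  by rewrite ln_ge0// ler1n muln_gt0.
(* As [2048 <= c], the right side is at least [7200 L^3 W], while the left side is at most
   [(27 + 80) L^3 W]. *)
have hx : 27 * (L ^+ 3 * W) + n%:R <= m%:R / (2048 * s%:R).
  have d0 : 0 < 2048 * s%:R :> R by apply: mulr_gt0; [clear; lra | exact: s0'].
  rewrite (ler_pdivlMr _ _ d0); apply: le_trans hm.
  have n10 : n%:R <= 80 * (L ^+ 3 * W) by rewrite nE; exact: levels_le_cube.
  have z0 : 0 <= L ^+ 3 * W.
    by apply: mulr_ge0 => //; apply: exprn_ge0; rewrite ln_ge0// ler1n.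
  have -> : 7200 * c * s%:R * L ^+ 3 * W = 7200 * c * (L ^+ 3 * W) * s%:R.
    by clear; move: (s%:R : R) => x; ring.
  rewrite [leLHS]mulrA; apply: ler_wpM2r => //.
  by clear -c0 z0 n10; move: (L ^+ 3 * W) (n%:R : R) z0 n10 => z y z0 n10; nra.
rewrite /powR gt_eqF ?ltr0n//.
(* The prefactor is moved into the exponent through [n <= expR n]. *)
apply: (@le_trans _ _ (expR n%:R * expR (- (m%:R / (2048 * s%:R))))).
  rewrite ler_wpM2r ?expR_ge0//.
  by apply: le_trans (expR_ge1Dx _); rewrite lerDr.
rewrite -expRD ler_expR mulNr -/W.
have : ln (3 * s%:R) ^+ 3 * W <= 27 * (L ^+ 3 * W).
  by rewrite mulrA ler_wpM2r// ln_triple_cube_le.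
clear -hx; move: (ln _ ^+ 3 * W) (L ^+ 3 * W) (_ / _) hx => x y z hx.
by move: (n%:R : R) hx => u hx h; lra.
Qed.

End SampleSize.

(** * Weighted l1-minimization *)

Section WeightedRecovery.
Context {R : realType}.

Lemma sup_norm_ge a b (g : R -> R) x : bounded_measurable a b g ->
  x \in `[a, b] -> `|g x| <= sup_norm a b g.
Proof.
move=> [_ [M hM]] xab; apply: ub_le_sup; last by exists x.
by exists M => _ [y yab <-]; exact: hM.
Qed.

Lemma bounded_measurable_residual a b (f : R -> R) (p : {poly R}) :
  {within `[a, b], continuous f} -> bounded_measurable a b (poly_residual f p).
Proof.
move=> cf; have bf := bounded_measurable_continuous cf.
have -> : poly_residual f p = (fun x => f x + -1 * p.[x]).
  by apply/funext => x; rewrite mulN1r.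
apply: bounded_measurableD => //; apply: bounded_measurableZ.
exact: bounded_measurable_horner.
Qed.

(** Minkowski's inequality from the pointwise bound [(f + g)^2 <= (1 + B/A) f^2 + (1 + A/B) g^2],
    whose defect is [(B f - A g)^2 / (A B)]. Adding [e / 2] to each norm keeps [A] and [B] positive
    when a norm vanishes. *)
Lemma L2_normD a b nu (f g : R -> R) : is_density a b nu ->
  bounded_measurable a b f -> bounded_measurable a b g ->
  L2_norm a b nu (fun x => f x + g x) <= L2_norm a b nu f + L2_norm a b nu g.
Proof.
move=> dens bf bg; apply/ler_addgt0Pr => e e0.
pose F := density_mean a b nu (fun x => f x ^+ 2).
pose G := density_mean a b nu (fun x => g x ^+ 2).
have F0 : 0 <= F by apply: density_mean_ge0 => // x _; exact: sqr_ge0.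
have G0 : 0 <= G by apply: density_mean_ge0 => // x _; exact: sqr_ge0.
pose A := Num.sqrt F + e / 2; pose B := Num.sqrt G + e / 2.
have A0 : 0 < A by rewrite ltr_wpDl ?sqrtr_ge0//; lra.
have B0 : 0 < B by rewrite ltr_wpDl ?sqrtr_ge0//; lra.
have FA : F <= A ^+ 2.
  by rewrite -[F]sqr_sqrtr// lerXn2r ?nnegrE ?sqrtr_ge0 ?ltW// ltrDl; lra.
have GB : G <= B ^+ 2.
  by rewrite -[G]sqr_sqrtr// lerXn2r ?nnegrE ?sqrtr_ge0 ?ltW// ltrDl; lra.
have -> : L2_norm a b nu f + L2_norm a b nu g + e = A + B.
  by rewrite /A /B /L2_norm -/(density_mean a b nu _) -/(density_mean a b nu _) -/F -/G; lra.
have AB0 : 0 <= A + B by rewrite addr_ge0// ltW.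
rewrite /L2_norm -[leRHS]ger0_norm// -sqrtr_sqr ler_wsqrtr//.
rewrite -/(density_mean a b nu (fun x => (f x + g x) ^+ 2)).
have bff := bounded_measurableM bf bf; have bgg := bounded_measurableM bg bg.
have bfg := bounded_measurableD bf bg.
apply: (@le_trans _ _ (density_mean a b nu
    (fun x => (1 + B / A) * (f x * f x) + (1 + A / B) * (g x * g x)))).
  apply: density_mean_le => //.
  - exact: (bounded_measurableM bfg bfg).
  - by apply: bounded_measurableD; exact: bounded_measurableZ.
  move=> x _; rewrite -subr_ge0.
  have -> : (1 + B / A) * (f x * f x) + (1 + A / B) * (g x * g x) - (f x + g x) ^+ 2 =
      (B * f x - A * g x) ^+ 2 / (A * B).
    by field; rewrite !gt_eqF.
  by rewrite divr_ge0 ?sqr_ge0// mulr_ge0 ?ltW.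
rewrite density_meanD//; try exact: bounded_measurableZ.
rewrite !density_meanZ// -/F -/G.
have r1 : 0 <= 1 + B / A by rewrite addr_ge0 ?divr_ge0 ?ltW.
have r2 : 0 <= 1 + A / B by rewrite addr_ge0 ?divr_ge0 ?ltW.
apply: le_trans (lerD (ler_wpM2l r1 FA) (ler_wpM2l r2 GB)) _.
by rewrite le_eqVlt; apply/orP; left; apply/eqP; field; rewrite !gt_eqF.
Qed.

Lemma horner_lin_comb n (psi : 'I_n -> {poly R}) (c : 'cV[R]_n) u :
  (lin_comb psi c).[u] = \sum_k c k 0 * (psi k).[u].
Proof. by rewrite /lin_comb horner_sum; apply: eq_bigr => k _; rewrite hornerZ. Qed.

Lemma density_mean_lin_comb_sq a b nu n (psi : 'I_n -> {poly R}) (c : 'cV[R]_n) :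
  is_density a b nu -> orthonormal_polys a b nu psi ->
  density_mean a b nu (fun u => (lin_comb psi c).[u] ^+ 2) = \sum_k c k 0 ^+ 2.
Proof.
move=> dens ortho.
have bp k := bounded_measurable_horner a b (psi k).
have bpp j k := bounded_measurableM (bp j) (bp k).
transitivity (density_mean a b nu (fun u => \sum_j \sum_k
    (c j 0 * c k 0) * ((psi j).[u] * (psi k).[u]))).
  apply: eq_density_mean => u _; rewrite expr2 horner_lin_comb mulr_suml.
  apply: eq_bigr => j _; rewrite mulr_sumr; apply: eq_bigr => k _; ring.
rewrite density_mean_sum//; last first.
  by move=> j _; apply: bounded_measurable_sum => k _; exact: bounded_measurableZ.
apply: eq_bigr => j _; rewrite density_mean_sum//; last first.
  by move=> k _; exact: bounded_measurableZ.
rewrite (bigD1 j)//= density_meanZ// /density_mean ortho eqxx mulr1 big1 ?addr0//.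
move=> k kj; have := density_meanZ dens (c j 0 * c k 0) (bpp j k).
by rewrite /density_mean => ->; rewrite ortho eq_sym (negbTE kj) mulr0.
Qed.

Lemma L2_norm_lin_comb a b nu n (psi : 'I_n -> {poly R}) (c : 'cV[R]_n) :
  is_density a b nu -> orthonormal_polys a b nu psi ->
  L2_norm a b nu (horner (lin_comb psi c)) = l2_norm c.
Proof.
by move=> dens ortho; rewrite /l2_norm -(density_mean_lin_comb_sq c dens ortho).
Qed.

Lemma l2_norm_sqr n (v : 'cV[R]_n) : l2_norm v ^+ 2 = \sum_i v i 0 ^+ 2.
Proof. by rewrite sqr_sqrtr// sumr_ge0// => i _; exact: sqr_ge0. Qed.

Lemma l2_norm_ge0 n (v : 'cV[R]_n) : 0 <= l2_norm v.
Proof. exact: sqrtr_ge0. Qed.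

Lemma wl1_norm_ge0 n (w v : 'cV[R]_n) : (forall j, 1 <= w j 0) -> 0 <= wl1_norm w v.
Proof.
move=> w1; apply: sumr_ge0 => j _; rewrite mulr_ge0//.
by rewrite (le_trans _ (w1 j)).
Qed.

Lemma best_sterm_error_ge0 n (s : R) (w x : 'cV[R]_n) : (forall j, 1 <= w j 0) ->
  0 <= s -> 0 <= best_sterm_error s w x.
Proof.
move=> w1 s0; apply: lb_le_inf; last first.
  by move=> _ [z _ <-]; exact: wl1_norm_ge0.
(* The zero vector is admissible, so the infimum runs over a nonempty set. *)
exists (wl1_norm w (x - 0)); exists 0 => //=.
by rewrite /wl0_norm big1// => j; rewrite mxE eqxx.
Qed.

(** The strict inequality provides an [s]-sparse [z] with [wl1_norm w (x - z) < q V]. Minimality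
    then bounds the norm of [v] by twice its part on the support of [z] plus twice that of [x - z],
    each of the two being at most [q V]. *)
Lemma wl1_minimizer_cone n (s : R) (w x c : 'cV[R]_n) : (forall j, 1 <= w j 0) ->
  0 < s -> wl1_norm w c <= wl1_norm w x ->
  best_sterm_error s w x < Num.sqrt s * l2_norm (x - c) ->
  wl1_norm w (x - c) <= 4 * Num.sqrt s * l2_norm (x - c).
Proof.
move=> w1 s0 cx /inf_lt; set v := x - c; set V := l2_norm v; set q := Num.sqrt s.
move=> []; first by exists (wl1_norm w (x - 0)); exists 0 => //=;
  rewrite /wl0_norm big1 ?ltW// => j; rewrite mxE eqxx.
move=> _ [z zs <-] zV.
have w0 j : 0 <= w j 0 by exact: le_trans (w1 j).
have q0 : 0 < q by rewrite sqrtr_gt0.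
have V0 : 0 < V.
  rewrite -(pmulr_rgt0 _ q0); apply: le_lt_trans zV; exact: wl1_norm_ge0.
(* Cauchy-Schwarz, obtained by summing [w |v| <= V w^2 / (2 q) + q v^2 / (2 V)]; the weighted
   sparsity bounds the sum of [w^2] by [q^2 = s]. *)
have supp : \sum_(j | z j 0 != 0) w j 0 * `|v j 0| <= q * V.
  apply: (@le_trans _ _ (\sum_(j | z j 0 != 0)
     (V / (2 * q) * w j 0 ^+ 2 + q / (2 * V) * v j 0 ^+ 2))).
    apply: ler_sum => j _; rewrite -[v j 0 ^+ 2]real_normK ?num_real// -subr_ge0.
    have -> : V / (2 * q) * w j 0 ^+ 2 + q / (2 * V) * `|v j 0| ^+ 2 - w j 0 * `|v j 0| =
       (V * w j 0 - q * `|v j 0|) ^+ 2 / (2 * q * V).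
      by field; rewrite !gt_eqF.
    by rewrite divr_ge0 ?sqr_ge0// !mulr_ge0 ?ltW.
  rewrite big_split /= -!mulr_sumr.
  have h1 : \sum_(j | z j 0 != 0) w j 0 ^+ 2 <= q ^+ 2 by rewrite sqr_sqrtr// ltW.
  have h2 : \sum_(j | z j 0 != 0) v j 0 ^+ 2 <= V ^+ 2.
    rewrite l2_norm_sqr big_mkcond /=; apply: ler_sum => j _.
    by case: ifP => // _; exact: sqr_ge0.
  have r1 : 0 <= V / (2 * q) by rewrite divr_ge0 ?mulr_ge0 ?ltW.
  have r2 : 0 <= q / (2 * V) by rewrite divr_ge0 ?mulr_ge0 ?ltW.
  apply: le_trans (lerD (ler_wpM2l r1 h1) (ler_wpM2l r2 h2)) _.
  by rewrite le_eqVlt; apply/orP; left; apply/eqP; field; rewrite !gt_eqF.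
(* Termwise: on the support of [z] use [|x| <= |v| + |c|]; off it [z = 0], and
   [|v| <= |x| + |c| = |c| - |x| + 2 |x - z|]. *)
have main : wl1_norm w v <= wl1_norm w c - wl1_norm w x +
    2 * (\sum_(j | z j 0 != 0) w j 0 * `|v j 0|) + 2 * wl1_norm w (x - z).
  rewrite [X in _ + 2 * X + _]big_mkcond /= /wl1_norm !mulr_sumr -sumrB -!big_split /=.
  apply: ler_sum => j _; rewrite !mxE.
  case: eqP => [-> /=|_ /=].
    rewrite mulr0 addr0 subr0.
    have := ler_normB (x j 0) (c j 0); have := w0 j.
    by move: (w j 0) `|_ - _| `|x j 0| `|c j 0| => W A B C; nra.
  have := ler_normD (x j 0 - c j 0) (c j 0); rewrite subrK.
  have := normr_ge0 (x j 0 - z j 0); have := w0 j.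
  by move: (w j 0) `|_ - c j 0| `|_ - z j 0| `|x j 0| `|c j 0| => W A Z B C; nra.
by move: main supp zV; rewrite -mulrA; move: (q * V) => t; lra.
Qed.

End WeightedRecovery.

(** * The cone as a convex hull of signed, normalised basis polynomials *)

Section SignedDictionary.
Context {R : realType}.
Variables (a b : R) (N : nat) (psi : 'I_N.+1 -> {poly R}) (w : 'cV[R]_N.+1).
Hypothesis w_ge1 : forall j, 1 <= w j 0.

(** The indicator makes the bound by 1 hold on the whole line and not just on the interval; the
    signs turn the convex hull into the image of a weighted l1 ball. *)
Definition signed_dictionary (d : bool * 'I_N.+1) (u : R) : R :=
  (-1) ^+ d.1 * (\1_(`[a, b]) u * ((psi d.2).[u] / w d.2 0)).

Lemma measurable_signed_dictionary d : measurable_fun setT (signed_dictionary d).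
Proof.
apply: measurable_funM => //; apply: measurable_funM => //.
apply: measurable_funM => //; apply: continuous_measurable_fun.
exact: continuous_horner.
Qed.

Lemma signed_dictionary_le1 d u :
  (forall j, sup_norm a b (horner (psi j)) <= w j 0) -> `|signed_dictionary d u| <= 1.
Proof.
move=> psiw; rewrite normrMsign indicE.
have [|_] := boolP (u \in _); last by rewrite mul0r normr0.
rewrite inE /= => uab; rewrite mul1r normrM normfV.
have w0 : 0 < w d.2 0 by exact: lt_le_trans (w_ge1 _).
rewrite (gtr0_norm w0) ler_pdivrMr// mul1r.
by apply: le_trans (psiw d.2); apply: sup_norm_ge => //; exact: bounded_measurable_horner.
Qed.

Lemma cone_in_hull (v : 'cV[R]_N.+1) (r : R) : 0 < r -> wl1_norm w v <= r ->
  exists lam : bool * 'I_N.+1 -> R,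
    [/\ forall d, 0 <= lam d, \sum_d lam d = 1 &
      forall u, hull signed_dictionary lam u =
        \1_(`[a, b]) u * ((lin_comb psi v).[u] / r)].
Proof.
move=> r0 vr.
have w0 k : 0 < w k 0 by exact: lt_le_trans (w_ge1 _).
pose x k := w k 0 * v k 0 / r.
have x1 : \sum_k `|x k| <= 1.
  have -> : \sum_k `|x k| = wl1_norm w v / r.
    rewrite /wl1_norm mulr_suml; apply: eq_bigr => k _.
    by rewrite !normrM normfV (gtr0_norm r0) (gtr0_norm (w0 k)).
  by rewrite ler_pdivrMr// mul1r.
(* The slack is spread evenly so that the weights sum to exactly 1. It enters both signs of [psi k]
   equally and cancels in the hull function, while the difference of the two weights is [x k]. *)
pose rest := (1 - \sum_k `|x k|) / N.+1%:R.
have rest0 : 0 <= rest by rewrite divr_ge0// subr_ge0.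
pose lam (d : bool * 'I_N.+1) := (`|x d.2| + rest + (-1) ^+ d.1 * x d.2) / 2.
exists lam; split.
- move=> d; rewrite divr_ge0// addrAC addr_ge0//.
  have := ler_norm (x d.2); have := ler_norm (- x d.2); rewrite normrN.
  by case: d.1; rewrite ?expr1 ?expr0; lra.
- rewrite -(pair_bigA _ (fun e k => (`|x k| + rest + (-1) ^+ nat_of_bool e * x k) / 2)) /=.
  rewrite big_bool /= -big_split /=.
  transitivity (\sum_k (`|x k| + rest)).
    by apply: eq_bigr => k _; rewrite expr1 expr0; lra.
  rewrite big_split /= sumr_const card_ord -[rest *+ _]mulr_natr /rest divfK.
    by rewrite addrC subrK.
  by rewrite pnatr_eq0.
- move=> u; rewrite /hull /signed_dictionary.
  rewrite -(pair_bigA _ (fun e k => (`|x k| + rest + (-1) ^+ nat_of_bool e * x k) / 2 *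
    ((-1) ^+ nat_of_bool e * (\1_(`[a, b]) u * ((psi k).[u] / w k 0))))) /=.
  rewrite big_bool /= -big_split /= horner_lin_comb mulr_suml mulr_sumr.
  apply: eq_bigr => k _; rewrite expr1 expr0 /x.
  by field; rewrite !gt_eqF.
Qed.

End SignedDictionary.

(** Dividing by [r = 4 sqrt(s) |v|_2] puts the polynomial of [v] in the hull with mean square
    exactly [1 / (16 s)], by orthonormality; multiplying the empirical bound by [m r^2] undoes the
    scaling. *)
Lemma cone_lower_bound (R : realType) (a b : R) (nu : R -> R) (N m s : nat)
    (psi : 'I_N.+1 -> {poly R}) (w : 'cV[R]_N.+1) (x : 'I_m -> R) :
  is_density a b nu -> orthonormal_polys a b nu psi ->
  (forall j, 1 <= w j 0) -> (0 < m)%N -> (0 < s)%N ->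
  (forall i, x i \in `[a, b]) ->
  (forall lam : bool * 'I_N.+1 -> R, (forall d, 0 <= lam d) -> \sum_d lam d = 1 ->
    (16 * s%:R)^-1 <=
      density_mean a b nu (fun u => hull (signed_dictionary a b psi w) lam u ^+ 2) ->
    (16 * s%:R)^-1 * (3 / 1024) <=
      empirical_mean x (fun u => hull (signed_dictionary a b psi w) lam u ^+ 2)) ->
  forall v : 'cV[R]_N.+1, wl1_norm w v <= 4 * Num.sqrt s%:R * l2_norm v ->
  m%:R * (3 / 1024) * l2_norm v ^+ 2 <= l2_norm (sampling_matrix psi x *m v) ^+ 2.
Proof.
move=> dens ortho w1 m0 s0 xab good v cone.
have Av i : (sampling_matrix psi x *m v) i 0 = (lin_comb psi v).[x i].
  by rewrite mxE horner_lin_comb; apply: eq_bigr => k _; rewrite mxE mulrC.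
rewrite [leRHS]l2_norm_sqr; under eq_bigr do rewrite Av.
have [v0|v0] := eqVneq (l2_norm v) 0.
  by rewrite v0 expr0n mulr0 sumr_ge0// => i _; exact: sqr_ge0.
have V0 : 0 < l2_norm v by rewrite lt_neqAle eq_sym v0 l2_norm_ge0.
have m0' : 0 < m%:R :> R by rewrite ltr0n.
have s0' : 0 < s%:R :> R by rewrite ltr0n.
set V := l2_norm v in V0 cone *.
have r0 : 0 < 4 * Num.sqrt s%:R * V by rewrite !mulr_gt0// sqrtr_gt0.
have r2 : (4 * Num.sqrt s%:R * V) ^+ 2 = 16 * s%:R * V ^+ 2.
  rewrite exprMn exprMn sqr_sqrtr ?ler0n//; congr (_ * _ * _).
  by rewrite expr2; lra.
have [lam [lam0 lam1 hullE]] := cone_in_hull a b psi w1 r0 cone.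
set r := 4 * _ * _ in r0 r2 hullE.
have hsq u : u \in `[a, b] -> hull (signed_dictionary a b psi w) lam u ^+ 2 =
    r ^- 2 * (lin_comb psi v).[u] ^+ 2.
  move=> uab; rewrite hullE indicE mem_set// mul1r expr_div_n mulrC.
  by [].
have mean : density_mean a b nu
    (fun u => hull (signed_dictionary a b psi w) lam u ^+ 2) = (16 * s%:R)^-1.
  rewrite (eq_density_mean nu hsq) density_meanZ//; last first.
    exact: (bounded_measurableM (bounded_measurable_horner _ _ _)
      (bounded_measurable_horner _ _ _)).
  rewrite density_mean_lin_comb_sq// -l2_norm_sqr -/V r2.
  by field; rewrite !gt_eqF.
have := good lam lam0 lam1; rewrite mean => /(_ (lexx _)).
rewrite /empirical_mean (eq_bigr (fun i => r ^- 2 * (lin_comb psi v).[x i] ^+ 2));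
  last by move=> i _; exact: hsq.
rewrite -mulr_sumr r2; set S := \sum_(_ < _) _ => h.
have k0 : 0 < m%:R * (16 * s%:R * V ^+ 2).
  by rewrite mulr_gt0// mulr_gt0// ?exprn_gt0// mulr_gt0//; lra.
have := ler_wpM2l (ltW k0) h.
have -> : m%:R * (16 * s%:R * V ^+ 2) * (m%:R^-1 * ((16 * s%:R * V ^+ 2)^-1 * S)) = S.
  by field; rewrite !gt_eqF.
have -> : m%:R * (16 * s%:R * V ^+ 2) * ((16 * s%:R)^-1 * (3 / 1024)) =
    m%:R * (3 / 1024) * V ^+ 2 by field; rewrite gt_eqF.
by [].
Qed.

(** * Assembling the recovery estimate *)

Theorem theorem4p3 (R : realType) :
  exists C F2 G2 : R, [/\ 0 < C, 0 < F2, 0 < G2 &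
  forall (Theta : nat) (a b : R) (nu : R -> R) (N m s : nat)
    (psi : 'I_N.+1 -> {poly R}) (w : 'cV[R]_N.+1)
    (d : measure_display) (T : measurableType d) (P : probability T R)
    (X : 'I_m -> {RV P >-> R})
    (f : R -> R) (popt : {poly R}) (copt : 'cV[R]_N.+1),
  (0 < Theta)%N -> a < b -> is_density a b nu ->
  (0 < N)%N -> (0 < m)%N -> (0 < s)%N ->
  C * s%:R * ln s%:R ^+ 3 * ln N.+1%:R <= m%:R ->
  orthonormal_polys a b nu psi ->
  (forall j k : 'I_N.+1, (j < k)%N -> (size (psi j) < size (psi k))%N) ->
  (forall j, (size (psi j) <= N.+1)%N) ->
  (forall j, 1 <= w j 0) ->
  (forall j, sup_norm a b (horner (psi j)) <= w j 0) ->
  2 * `|w| ^+ 2 <= s%:R ->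
  mutually_independent X ->
  (forall j, has_density_on a b nu (X j)) ->
  {within `[a, b], continuous f} ->
  is_best_approx a b nu f N popt ->
  popt = lin_comb psi copt ->
  exists E : set T, [/\ measurable E,
    ((1 - N.+1%:R `^ (- (ln (3 * s%:R) ^+ 3)))%:E <= P E)%E &
    forall t, E t ->
    forall c : 'cV[R]_N.+1,
    is_wl1_minimizer w
      (sampling_matrix psi (fun j => X j t))
      (sample_vector f (fun j => X j t))
      (Theta%:R * Num.sqrt m%:R * sup_norm a b (poly_residual f popt)) c ->
    L2_norm a b nu (poly_residual f (lin_comb psi c)) <=
      L2_norm a b nu (poly_residual f popt)
      + F2 * (best_sterm_error s%:R w copt / Num.sqrt s%:R)
      + Theta%:R * G2 * sup_norm a b (poly_residual f popt)]].
Proof.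
(* The cone case needs [G2^2 >= 4 * 1024 / 3], and [40^2 = 1600] suffices. *)
exists (7200 * 2 ^+ 21), 1, 40; split; [|exact: ltr01|by rewrite ltr0n|].
  by apply: mulr_gt0; [rewrite ltr0n | apply: exprn_gt0; rewrite ltr0n].
move=> Theta a b nu N m s psi w d T P X f popt copt.
move=> Theta0 ab dens N0 m0 s0 hm ortho _ _ w1 psiw ws indepX lawX cf _ ->.
(* Weights at least 1 and [s >= 2 |w|^2] exclude [s = 1], for which [ln s] would vanish. *)
have s2 : (2 <= s)%N.
  have w00 : 1 <= `|w|.
    apply: (le_trans (w1 ord0)); apply: (le_trans (ler_norm _)).
    by rewrite [leRHS]mx_normrE; exact: (le_bigmax _ (fun ij => `|w ij.1 ij.2|) (ord0, 0)).
  rewrite -(ler_nat R); apply: le_trans ws; rewrite -[leLHS]mulr1.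
  by rewrite ler_wpM2l// exprn_ege1.
have [hm1 hm2] := sample_size_bounds s2 (N0 : (2 <= N.+1)%N) hm.
have dm := measurable_signed_dictionary a b psi w.
have d1 dd u := signed_dictionary_le1 (a := a) (b := b) w1 dd u psiw.
have cardD : #|{: bool * 'I_N.+1}| = (2 * N.+1)%N by rewrite card_prod card_bool card_ord.
have r0 : (0 < trunc_log 2 s + 14)%N by rewrite addn_gt0 orbT.
have D0 : (0 < #|{: bool * 'I_N.+1}|)%N by rewrite cardD.
rewrite -cardD in hm1.
have [E [mE PE goodE]] := sampling_event dens dm d1 m0 indepX lawX s0 r0 D0
  (truncation_level s0) (maurey_error_le s0) hm1.
exists E; split => //.
  by apply: le_trans PE; rewrite lee_fin lerD2l lerN2.
move=> t /goodE[xab good] c [feasc minc].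
set x := fun j => X j t in feasc minc good.
set A := sampling_matrix psi x in feasc minc *.
set y := sample_vector f x in feasc minc.
set p := lin_comb psi copt; set TN := sup_norm a b (poly_residual f p).
rewrite -/TN in feasc minc.
set eta := Theta%:R * Num.sqrt m%:R * TN in feasc minc.
have Theta1 : 1 <= Theta%:R :> R by rewrite ler1n.
have bres q : bounded_measurable a b (poly_residual f q).
  exact: bounded_measurable_residual.
have resT u : u \in `[a, b] -> `|poly_residual f p u| <= TN by exact: sup_norm_ge.
have TN0 : 0 <= TN by apply: le_trans (resT a _); rewrite // in_itv /= lexx ltW.
have eta0 : 0 <= eta by rewrite !mulr_ge0// sqrtr_ge0.
have eta2 : eta ^+ 2 = m%:R * (Theta%:R * TN) ^+ 2.
  by rewrite /eta !exprMn sqr_sqrtr//; ring.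
have Ac j : (A *m copt - y) j 0 = - poly_residual f p (x j).
  rewrite !mxE /poly_residual horner_lin_comb opprB; congr (_ - _).
  by apply: eq_bigr => k _; rewrite mxE mulrC.
(* Each sample residual of the best approximation is at most [TN] because the samples lie in the
   interval, and [Theta >= 1]. *)
have feasopt : l2_norm (A *m copt - y) <= eta.
  rewrite -(ler_pXn2r (isT : 0 < 2)%N) ?nnegrE ?l2_norm_ge0// l2_norm_sqr eta2.
  rewrite -[m in leRHS]card_ord mulr_natl -sumr_const; apply: ler_sum => j _.
  rewrite Ac sqrrN -real_normK ?num_real// lerXn2r ?nnegrE ?mulr_ge0//.
  by apply: (le_trans (resT _ (xab j))); rewrite ler_peMl.
have cle := minc _ feasopt.
set v := copt - c; set V := l2_norm v.
have V0 : 0 <= V by exact: l2_norm_ge0.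
have s0' : 0 < s%:R :> R by rewrite ltr0n.
have sq0 : 0 < Num.sqrt s%:R :> R by rewrite sqrtr_gt0.
have tri : L2_norm a b nu (poly_residual f (lin_comb psi c)) <=
    L2_norm a b nu (poly_residual f p) + V.
  rewrite /V -(L2_norm_lin_comb v dens ortho).
  have -> : poly_residual f (lin_comb psi c) =
      (fun u => poly_residual f p u + (lin_comb psi v).[u]).
    apply/funext => u; rewrite /poly_residual.
    have -> : (lin_comb psi v).[u] = p.[u] - (lin_comb psi c).[u].
      rewrite !horner_lin_comb -sumrB; apply: eq_bigr => k _.
      by rewrite !mxE mulrBl.
    by rewrite addrA subrK.
  by apply: L2_normD => //; exact: bounded_measurable_horner.
apply: (le_trans tri); rewrite -addrA lerD2l mul1r.
have sig0 : 0 <= best_sterm_error s%:R w copt by apply: best_sterm_error_ge0.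
(* In the first case the [F2] term alone bounds [V]; in the second, [v] lies in the cone and the
   [G2] term does. *)
have [sig|sig] := leP (Num.sqrt s%:R * V) (best_sterm_error s%:R w copt).
  apply: (@le_trans _ _ (best_sterm_error s%:R w copt / Num.sqrt s%:R)).
    by rewrite ler_pdivlMr// mulrC.
  by rewrite lerDl !mulr_ge0.
apply: (@le_trans _ _ (Theta%:R * 40 * TN)); last first.
  by rewrite lerDr divr_ge0// ltW.
have cone := wl1_minimizer_cone w1 s0' cle sig.
have low := cone_lower_bound dens ortho w1 m0 s0 xab good cone.
rewrite -/A -/v -/V in low.
(* Both [copt] and [c] are feasible, so the data vector [y] cancels in the difference. *)
have up : l2_norm (A *m v) ^+ 2 <= 4 * eta ^+ 2.
  apply: (@le_trans _ _ (2 * l2_norm (A *m copt - y) ^+ 2 + 2 * l2_norm (A *m c - y) ^+ 2)).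
    rewrite !l2_norm_sqr !mulr_sumr -big_split /=; apply: ler_sum => j _.
    rewrite mulmxBr [(A *m copt - A *m c) j 0]mxE [(- (A *m c)) j 0]mxE.
    rewrite [(A *m copt - y) j 0]mxE [(A *m c - y) j 0]mxE [(- y) j 0]mxE.
    move: ((A *m copt) j 0) ((A *m c) j 0) (y j 0); clear => p1 p2 p3.
    by have := sqr_ge0 (p1 - p3 + (p2 - p3)); rewrite !expr2; lra.
  have h1 : l2_norm (A *m copt - y) ^+ 2 <= eta ^+ 2.
    by rewrite lerXn2r ?nnegrE ?l2_norm_ge0.
  have h2 : l2_norm (A *m c - y) ^+ 2 <= eta ^+ 2.
    by rewrite lerXn2r ?nnegrE ?l2_norm_ge0.
  by clear -h1 h2; lra.
have m0' : 0 < m%:R :> R by rewrite ltr0n.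
have V2 : V ^+ 2 <= (Theta%:R * 40 * TN) ^+ 2.
  rewrite -(ler_pM2l m0').
  have := le_trans low up; rewrite eta2 => h.
  have -> : (Theta%:R * 40 * TN) ^+ 2 = 1600 * (Theta%:R * TN) ^+ 2 by ring.
  have : 0 <= m%:R * (Theta%:R * TN) ^+ 2 by rewrite mulr_ge0 ?sqr_ge0.
  clear -h; move: (V ^+ 2) ((Theta%:R * TN) ^+ 2) (m%:R : R) h => g z k h.
  by clear -h; lra.
rewrite -(ler_pXn2r (isT : 0 < 2)%N) ?nnegrE//.
by rewrite !mulr_ge0// ler0n.
Qed.
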